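(* Let $N$ be an integer with $N\ge d_F+k-1$, let $M=N+2k+d_F$, and let $\mathcal{Y}$ be the list of auxiliary matrix variables defined in the context. The set $T_N^{\mathrm{in}}\subset\mathbb{R}^s$ of values $\gamma\in\mathbb{R}^s$ for which there exists $\mathcal{Y}$ such that $$\overline{\Omega}(\gamma,\mathcal{Y})\succeq0,\qquad \Pi_M^T\,Q_M(\gamma,\mathcal{Y})\,\Pi_M\succeq0,\qquad S(x;\gamma)-\Sigma_M(\gamma,\mathcal{Y})\succeq0\quad\forall x\in[-1,1],$$ is an inner approximation of the set $T=\{\gamma\in\mathbb{R}^s:\ \mathcal{F}_\gamma\{w\}\ge0\ \text{ for all } w\in H\}$, i.e., $T_N^{\mathrm{in}}\subset T$.
   Context: Setting. Let $m,k,l$ be integers with $1\le k\le m-1$ and $k\le l\le m$. For $w=[u,v]^T=[w_1,w_2]^T\in C^m([-1,1],\mathbb{R}^2)$ and $0\le i\le j\le m$ let $\mathcal{D}^{[i,j]}w=[\partial^iw_1,\dots,\partial^jw_1,\partial^iw_2,\dots,\partial^jw_2]^T$, let $\mathcal{B}^{[i,j]}w$ be the vector obtained by stacking $\mathcal{D}^{[i,j]}w(-1)$ and $\mathcal{D}^{[i,j]}w(1)$, and write $\mathcal{D}^j=\mathcal{D}^{[0,j]}$, $\mathcal{B}^j=\mathcal{B}^{[0,j]}$. Let $F(x;\gamma)=F_0(x)+\sum_{i=1}^s\gamma_iF_i(x)$, where the $F_i$ are symmetric $2(k+1)\times2(k+1)$ matrices of polynomials of degree at most $d_F$. Let $A\in\mathbb{R}^{p\times4(l+1)}$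 and $$\mathcal{F}_\gamma\{w\}=\int_{-1}^1(\mathcal{D}^kw)^TF(x;\gamma)\mathcal{D}^kw\,dx,\qquad H=\{w\in C^m([-1,1],\mathbb{R}^2):A\,\mathcal{B}^lw=0\}.$$ For $a,b\in\{1,2\}$ and $\alpha,\beta\in\{0,\dots,k\}$ let $f_{ab}^{\alpha\beta}(x;\gamma)$ be the entry of $F(x;\gamma)$ in the row of $\partial^\alpha w_a$ and the column of $\partial^\beta w_b$, and let $\|\hat f_{ab}^{\alpha\beta}(\gamma)\|_1$ be the sum of the absolute values of its Legendre coefficients. Let $S(x;\gamma)$ be the symmetric $2\times2$ matrix with entries $S_{ab}=f_{ab}^{kk}$. Legendre expansions. Let $\mathcal{L}_n$ be the Legendre polynomial of degree $n$, and let $\hat w_{a,n}^\alpha=\frac{2n+1}{2}\int_{-1}^1\partial^\alpha w_a\,\mathcal{L}_n\,dx$, so $\partial^\alpha w_a=\sum_{n\ge0}\hat w_{a,n}^\alpha\mathcal{L}_n$. Let $W_{a,i}^\alpha=\sum_{n>i}\hat w_{a,n}^\alpha\mathcal{L}_n$, and write $U_M^k=W_{1,M}^k$, $V_M^k=W_{2,M}^k$. Let $\check w_a=[w_a(-1),\dots,\partial^{k-1}w_a(-1),\hat w_{a,0}^k,\dots,\hat w_{a,M}^k]^T\in\mathbb{R}^{k+M+1}$ and $\psi_M=[\check w_1^T,\check w_2^T]^T\in\mathbb{R}^{2(k+M+1)}$. Put $N_\alpha=N+\alpha$, $N_\beta=N+\beta$ if $(\alpha,\beta)\ne(k,k)$,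 and $N_\alpha=N_\beta=M$ if $\alpha=\beta=k$. With $f=f_{ab}^{\alpha\beta}$, define $$\mathcal{P}_{ab}^{\alpha\beta}=\sum_{i=0}^{N_\alpha}\sum_{j=0}^{N_\beta}\hat w_{a,i}^\alpha\hat w_{b,j}^\beta\int_{-1}^1f\mathcal{L}_i\mathcal{L}_j\,dx,\qquad \mathcal{R}_{ab}^{\alpha\beta}=\int_{-1}^1f\,W_{a,N_\alpha}^\alpha W_{b,N_\beta}^\beta\,dx,$$ $$\mathcal{Q}_{ab}^{\alpha\beta}=\sum_{i=0}^{N_\alpha}\hat w_{a,i}^\alpha\int_{-1}^1f\mathcal{L}_iW_{b,N_\beta}^\beta\,dx+\sum_{j=0}^{N_\beta}\hat w_{b,j}^\beta\int_{-1}^1f\mathcal{L}_jW_{a,N_\alpha}^\alpha\,dx ,$$ so that $\int_{-1}^1f\,\partial^\alpha w_a\,\partial^\beta w_b\,dx=\mathcal{P}_{ab}^{\alpha\beta}+\mathcal{Q}_{ab}^{\alpha\beta}+\mathcal{R}_{ab}^{\alpha\beta}$. Fixed matrices. The following matrices exist and are fixed; all identities and bounds hold for all $w\in C^m([-1,1],\mathbb{R}^2)$ and all $\gamma$. For all $a,b,\alpha,\beta$: $P_{ab}^{\alpha\beta}(\gamma)$ symmetric, affine in $\gamma$, with $\mathcal{P}_{ab}^{\alpha\beta}=\psi_M^TP_{ab}^{\alpha\beta}(\gamma)\psi_M$. For $(\alpha,\beta)\ne(k,k)$: $Q_{ab}^{\alpha\beta}(\gamma)$ symmetric, affine in $\gamma$,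 with $\mathcal{Q}_{ab}^{\alpha\beta}=\psi_M^TQ_{ab}^{\alpha\beta}(\gamma)\psi_M$; and $R_{ab}^{\alpha\beta}\succeq0$, $\Sigma_{ab}^{\alpha\beta}\succ0$ (of size $2\times 2$), independent of $\gamma$, with $$|\mathcal{R}_{ab}^{\alpha\beta}|\le\|\hat f_{ab}^{\alpha\beta}(\gamma)\|_1\Big(\psi_M^TR_{ab}^{\alpha\beta}\psi_M+\int_{-1}^1\begin{bmatrix}U_M^k\\ V_M^k\end{bmatrix}^T\Sigma_{ab}^{\alpha\beta}\begin{bmatrix}U_M^k\\ V_M^k\end{bmatrix}dx\Big).$$ Auxiliary variables. $\mathcal{Y}=\{Q_{11}^{kk},\Sigma_{11}^{kk},Q_{12}^{kk},\Sigma_{12}^{kk},Q_{22}^{kk},\Sigma_{22}^{kk}\}$ with each $Q_{ab}^{kk}$ a symmetric $2d_F\times2d_F$ matrix and each $\Sigma_{ab}^{kk}$ a diagonal $2\times2$ matrix. Let $\Delta=\mathrm{Diag}\big(\tfrac{2}{2(M+1)+1},\dots,\tfrac{2}{2(M+d_F)+1}\big)$, let $\Phi_{ab}$ be the $d_F\times d_F$ matrix with entries $\int_{-1}^1S_{ab}(x;\gamma)\mathcal{L}_{M-d_F+i}\mathcal{L}_{M+j}\,dx$, $1\le i,j\le d_F$, and let $$Y_{11}=\begin{bmatrix}\Phi_{11}&0\\0&0\end{bmatrix},\quad Y_{12}=\tfrac12\begin{bmatrix}0&\Phi_{12}\\ \Phi_{12}&0\end{bmatrix},\quad Y_{22}=\begin{bmatrix}0&0\\0&\Phi_{22}\end{bmatrix},\quad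 \Omega_{ab}=\begin{bmatrix}Q_{ab}^{kk}&Y_{ab}\\ Y_{ab}^T&\Sigma_{ab}^{kk}\otimes\Delta\end{bmatrix}.$$ $\overline{\Omega}(\gamma,\mathcal{Y})$ is the block-diagonal matrix with blocks $\Omega_{11},\Omega_{12},\Omega_{22}$. Let $L$ be the matrix with $L\psi_M=[\hat w_{1,M+1-d_F}^k,\dots,\hat w_{1,M}^k,\hat w_{2,M+1-d_F}^k,\dots,\hat w_{2,M}^k]^T$. (If $d_F=0$ these auxiliary variables and LMIs are absent, i.e. the corresponding terms are zero.) The matrices $Q_M$ and $\Sigma_M$. $$Q_M(\gamma,\mathcal{Y})=P_{11}^{kk}+2P_{12}^{kk}+P_{22}^{kk}-L^T(Q_{11}^{kk}+2Q_{12}^{kk}+Q_{22}^{kk})L+\sum\big(P_{ab}^{\alpha\beta}+Q_{ab}^{\alpha\beta}-\|\hat f_{ab}^{\alpha\beta}(\gamma)\|_1R_{ab}^{\alpha\beta}\big),$$ $$\Sigma_M(\gamma,\mathcal{Y})=\Sigma_{11}^{kk}+2\Sigma_{12}^{kk}+\Sigma_{22}^{kk}+\sum\|\hat f_{ab}^{\alpha\beta}(\gamma)\|_1\Sigma_{ab}^{\alpha\beta},$$ where both sums are over all $a,b\in\{1,2\}$ and $(\alpha,\beta)\in\{0,\dots,k\}^2\setminus\{(k,k)\}$. The matrix $\Pi_M$. Let $P$ be the permutation matrix with $\mathcal{B}^lw=P\begin{bmatrix}\mathcal{B}^{k-1}w\\ \mathcal{B}^{[k,l]}w\end{bmatrix}$,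 let $J$ be the matrix with $\mathcal{B}^{k-1}w=J\psi_M$ for all $w\in C^m([-1,1],\mathbb{R}^2)$ (it exists), and let $K=AP\begin{bmatrix}J&0\\0&I\end{bmatrix}$. Let $\Lambda$ be a matrix with $\dim\mathcal{N}(K)$ columns whose range is the null space $\mathcal{N}(K)$; $\Pi_M$ consists of the first $2(k+M+1)$ rows of $\Lambda$. Hence $\psi_M=\Pi_M\zeta$ for some $\zeta$ whenever $w\in H$. *)

(* Defs.v *)
From HB Require Import structures.
From mathcomp Require Import all_boot all_order all_algebra.
From mathcomp Require Import all_classical all_reals all_analysis.

Set Implicit Arguments.
Unset Strict Implicit.
Unset Printing Implicit Defensive.

Import Order.TTheory GRing.Theory Num.Theory.
Import numFieldNormedType.Exports.

Local Open Scope classical_set_scope.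
Local Open Scope ring_scope.

(* The indices a, b in {1, 2} are represented by 0, 1 : 'I_2, and
   w = [w_1, w_2]^T by w : 'I_2 -> R -> R.  Only the values of w on [-1, 1]
   are ever used. *)

Definition int11 (R : realType) (f : R -> R) : R :=
  \int[lebesgue_measure]_(x in `[-1, 1]) f x.

(* The limit is taken within [-1, 1]: it is the one-sided derivative at -1
   and at 1. *)
Definition deriv11 (R : realType) (f : R -> R) (x : R) : R :=
  lim ((fun y => (f y - f x) / (y - x)) @ within `[-1, 1] x^').

Definition dern (R : realType) (n : nat) (f : R -> R) : R -> R :=
  iter n (@deriv11 R) f.

Definition Cm (R : realType) (m : nat) (f : R -> R) : Prop :=
  (forall (i : nat) (x : R), (i < m)%N -> x \in `[-1, 1] ->
     cvg ((fun y => (dern i f y - dern i f x) / (y - x))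
            @ within `[-1, 1] x^')) /\
  (forall i : nat, (i <= m)%N -> {within `[-1, 1], continuous (dern i f)}).

Definition Cm2 (R : realType) (m : nat) (w : 'I_2 -> R -> R) : Prop :=
  forall a : 'I_2, Cm m (w a).

Definition Dvec (R : realType) (i j : nat) (w : 'I_2 -> R -> R) (x : R)
    : 'cV[R]_((j.+1 - i) + (j.+1 - i)) :=
  col_mx (\col_(c < (j.+1 - i)%N) dern (i + c) (w 0) x)
         (\col_(c < (j.+1 - i)%N) dern (i + c) (w 1) x).

Notation bdim i j :=
  (((j.+1 - i) + (j.+1 - i)) + ((j.+1 - i) + (j.+1 - i)))%N (only parsing).

Definition Bvec (R : realType) (i j : nat) (w : 'I_2 -> R -> R)
    : 'cV[R]_(bdim i j) :=
  col_mx (Dvec i j w (-1)) (Dvec i j w 1).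

Definition qform (R : realType) (n : nat) (A : 'M[R]_n) (v : 'cV[R]_n) : R :=
  (v^T *m A *m v) 0 0.

Definition psd (R : realType) (n : nat) (A : 'M[R]_n) : Prop :=
  A^T = A /\ forall v : 'cV[R]_n, 0 <= qform A v.

Definition pd (R : realType) (n : nat) (A : 'M[R]_n) : Prop :=
  A^T = A /\ forall v : 'cV[R]_n, v != 0 -> 0 < qform A v.

Definition affine_mx (R : realType) (s n : nat) (P : 'rV[R]_s -> 'M[R]_n)
    : Prop :=
  exists (C : 'M[R]_n) (D : 'I_s -> 'M[R]_n),
    forall g : 'rV[R]_s, P g = C + \sum_(i < s) g 0 i *: D i.

(* Permutation matrices whose numbers of rows and columns are equal, but not
   convertible. *)
Definition rect_perm_mx (R : realType) (q r : nat) (P : 'M[R]_(q, r)) : Prop :=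
  exists e : r = q, is_perm_mx (castmx (erefl q, e) P).

(* Rodrigues' formula. *)
Definition legendre (R : realType) (n : nat) : {poly R} :=
  (2 ^+ n * n`!%:R)^-1 *: (('X^2 - 1) ^+ n)^`(n).

Definition lcoef (R : realType) (f : R -> R) (n : nat) : R :=
  (2 * n + 1)%:R / 2 * int11 (fun x => f x * (legendre R n).[x]).

(* The Legendre coefficients of p of index at least size p are zero. *)
Definition lnorm1 (R : realType) (p : {poly R}) : R :=
  \sum_(n < size p) `|lcoef (horner p) n|.

Definition wcoef (R : realType) (w : 'I_2 -> R -> R) (a : 'I_2)
    (alpha n : nat) : R :=
  lcoef (dern alpha (w a)) n.

(* W_{a,i}^alpha, the sum of the Legendre series over the indices n > i. *)
Definition wtail (R : realType) (w : 'I_2 -> R -> R) (a : 'I_2)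
    (alpha i : nat) (x : R) : R :=
  limn (fun n => \sum_(i.+1 <= j < n) wcoef w a alpha j * (legendre R j).[x]).

Definition wcheck (R : realType) (k M : nat) (w : 'I_2 -> R -> R) (a : 'I_2)
    : 'cV[R]_(k + M.+1) :=
  col_mx (\col_(i < k) dern i (w a) (-1)) (\col_(n < M.+1) wcoef w a k n).

Notation pdim k M := ((k + M.+1) + (k + M.+1))%N (only parsing).

Definition psi (R : realType) (k M : nat) (w : 'I_2 -> R -> R)
    : 'cV[R]_(pdim k M) :=
  col_mx (wcheck k M w 0) (wcheck k M w 1).

Definition Fgam (R : realType) (k s : nat) (F0 : 'M[{poly R}]_(k.+1 + k.+1))
    (Fi : 'I_s -> 'M[{poly R}]_(k.+1 + k.+1)) (g : 'rV[R]_s)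
    : 'M[{poly R}]_(k.+1 + k.+1) :=
  F0 + \sum_(i < s) (g 0 i)%:P *: Fi i.

(* The position of the alpha-th derivative of w_a in D^k w. *)
Definition pos (k : nat) (a : 'I_2) (alpha : 'I_k.+1) : 'I_(k.+1 + k.+1) :=
  if a == 0 then lshift k.+1 alpha else rshift k.+1 alpha.

Definition fent (R : realType) (k : nat) (F : 'M[{poly R}]_(k.+1 + k.+1))
    (a b : 'I_2) (alpha beta : 'I_k.+1) : {poly R} :=
  F (pos a alpha) (pos b beta).

Definition Smx (R : realType) (k : nat) (F : 'M[{poly R}]_(k.+1 + k.+1))
    (x : R) : 'M[R]_2 :=
  \matrix_(a < 2, b < 2) (fent F a b ord_max ord_max).[x].

Definition Fcal (R : realType) (k : nat) (F : 'M[{poly R}]_(k.+1 + k.+1))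
    (w : 'I_2 -> R -> R) : R :=
  int11 (fun x => qform (map_mx (fun q : {poly R} => q.[x]) F)
                        (Dvec 0 k w x : 'cV[R]_(k.+1 + k.+1))).

Definition Hspace (R : realType) (m l p : nat) (A : 'M[R]_(p, bdim 0 l))
    : set ('I_2 -> R -> R) :=
  [set w | Cm2 m w /\ A *m Bvec 0 l w = 0].

Definition Tset (R : realType) (m k l p s : nat)
    (F0 : 'M[{poly R}]_(k.+1 + k.+1))
    (Fi : 'I_s -> 'M[{poly R}]_(k.+1 + k.+1)) (A : 'M[R]_(p, bdim 0 l))
    : set 'rV[R]_s :=
  [set g | forall w, Hspace m A w -> 0 <= Fcal (Fgam F0 Fi g) w].

(* N_alpha is trunc N M alpha beta and N_beta is trunc N M beta alpha. *)
Definition trunc (k N M : nat) (alpha beta : 'I_k.+1) : nat :=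
  if (alpha == ord_max) && (beta == ord_max) then M else (N + alpha)%N.

Definition Pcal (R : realType) (k N M : nat) (f : {poly R})
    (w : 'I_2 -> R -> R) (a b : 'I_2) (alpha beta : 'I_k.+1) : R :=
  \sum_(i < (trunc N M alpha beta).+1) \sum_(j < (trunc N M beta alpha).+1)
    wcoef w a alpha i * wcoef w b beta j
    * int11 (fun x => f.[x] * (legendre R i).[x] * (legendre R j).[x]).

Definition Rcal (R : realType) (k N M : nat) (f : {poly R})
    (w : 'I_2 -> R -> R) (a b : 'I_2) (alpha beta : 'I_k.+1) : R :=
  int11 (fun x => f.[x] * wtail w a alpha (trunc N M alpha beta) x
                        * wtail w b beta (trunc N M beta alpha) x).

Definition Qcal (R : realType) (k N M : nat) (f : {poly R})
    (w : 'I_2 -> R -> R) (a b : 'I_2) (alpha beta : 'I_k.+1) : R :=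
  (\sum_(i < (trunc N M alpha beta).+1) wcoef w a alpha i
     * int11 (fun x => f.[x] * (legendre R i).[x]
                             * wtail w b beta (trunc N M beta alpha) x))
  + \sum_(j < (trunc N M beta alpha).+1) wcoef w b beta j
     * int11 (fun x => f.[x] * (legendre R j).[x]
                             * wtail w a alpha (trunc N M alpha beta) x).

Definition UV (R : realType) (k M : nat) (w : 'I_2 -> R -> R) (x : R)
    : 'cV[R]_2 :=
  \col_(a < 2) wtail w a k M x.

Record auxvars (R : realType) (dF : nat) := Auxvars {
  Qk11 : 'M[R]_(dF + dF);
  Sk11 : 'M[R]_2;
  Qk12 : 'M[R]_(dF + dF);
  Sk12 : 'M[R]_2;
  Qk22 : 'M[R]_(dF + dF);
  Sk22 : 'M[R]_2
}.

(* For dF = 0 there are no auxiliary variables: the Qk's have size 0, and the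
   last clause makes the terms in the Sk's vanish. *)
Definition aux_ok (R : realType) (dF : nat) (Y : auxvars R dF) : Prop :=
  [/\ (Qk11 Y)^T = Qk11 Y, (Qk12 Y)^T = Qk12 Y & (Qk22 Y)^T = Qk22 Y] /\
  [/\ is_diag_mx (Sk11 Y), is_diag_mx (Sk12 Y) & is_diag_mx (Sk22 Y)] /\
  (dF = 0%N -> [/\ Sk11 Y = 0, Sk12 Y = 0 & Sk22 Y = 0]).

Definition DeltaM (R : realType) (dF M : nat) : 'M[R]_dF :=
  diag_mx (\row_(i < dF) (2 / (2 * (M + i.+1) + 1)%:R)).

(* The Kronecker product of a 2 x 2 matrix with B. *)
Definition kron2 (R : realType) (d : nat) (A : 'M[R]_2) (B : 'M[R]_d)
    : 'M[R]_(d + d) :=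
  block_mx (A 0 0 *: B) (A 0 1 *: B) (A 1 0 *: B) (A 1 1 *: B).

(* The index shift i.+1, j.+1 accounts for 'I_dF starting at 0. *)
Definition Phi (R : realType) (k dF M : nat)
    (F : 'M[{poly R}]_(k.+1 + k.+1)) (a b : 'I_2) : 'M[R]_dF :=
  \matrix_(i < dF, j < dF)
    int11 (fun x => Smx F x a b * (legendre R (M - dF + i.+1)).[x]
                                * (legendre R (M + j.+1)).[x]).

Definition Omega (R : realType) (dF M : nat) (Q Yab : 'M[R]_(dF + dF))
    (Sig : 'M[R]_2) : 'M[R]_((dF + dF) + (dF + dF)) :=
  block_mx Q Yab Yab^T (kron2 Sig (DeltaM R dF M)).

Definition Omegabar (R : realType) (k dF M : nat)
    (F : 'M[{poly R}]_(k.+1 + k.+1)) (Y : auxvars R dF) :=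
  let Y11 := block_mx (Phi dF M F 0 0) 0 0 0 in
  let Y12 := 2^-1 *: block_mx 0 (Phi dF M F 0 1) (Phi dF M F 0 1) 0 in
  let Y22 := block_mx 0 0 0 (Phi dF M F 1 1) in
  block_mx (Omega M (Qk11 Y) Y11 (Sk11 Y)) 0
           0 (block_mx (Omega M (Qk12 Y) Y12 (Sk12 Y)) 0
                       0 (Omega M (Qk22 Y) Y22 (Sk22 Y))).

Definition Lvec (R : realType) (k dF M : nat) (w : 'I_2 -> R -> R)
    : 'cV[R]_(dF + dF) :=
  col_mx (\col_(i < dF) wcoef w 0 k (M + 1 - dF + i))
         (\col_(i < dF) wcoef w 1 k (M + 1 - dF + i)).

Definition QM (R : realType) (k s dF M : nat)
    (F : 'rV[R]_s -> 'M[{poly R}]_(k.+1 + k.+1))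
    (P Q : 'I_2 -> 'I_2 -> 'I_k.+1 -> 'I_k.+1 -> 'rV[R]_s -> 'M[R]_(pdim k M))
    (Rm : 'I_2 -> 'I_2 -> 'I_k.+1 -> 'I_k.+1 -> 'M[R]_(pdim k M))
    (L : 'M[R]_(dF + dF, pdim k M))
    (g : 'rV[R]_s) (Y : auxvars R dF) : 'M[R]_(pdim k M) :=
  P 0 0 ord_max ord_max g + 2 *: P 0 1 ord_max ord_max g
  + P 1 1 ord_max ord_max g
  - L^T *m (Qk11 Y + 2 *: Qk12 Y + Qk22 Y) *m L
  + \sum_(a < 2) \sum_(b < 2) \sum_(alpha < k.+1)
      \sum_(beta < k.+1 | (alpha, beta) != (ord_max, ord_max))
      (P a b alpha beta g + Q a b alpha beta g
       - lnorm1 (fent (F g) a b alpha beta) *: Rm a b alpha beta).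

Definition SigmaM (R : realType) (k s dF : nat)
    (F : 'rV[R]_s -> 'M[{poly R}]_(k.+1 + k.+1))
    (Sig : 'I_2 -> 'I_2 -> 'I_k.+1 -> 'I_k.+1 -> 'M[R]_2)
    (g : 'rV[R]_s) (Y : auxvars R dF) : 'M[R]_2 :=
  Sk11 Y + 2 *: Sk12 Y + Sk22 Y
  + \sum_(a < 2) \sum_(b < 2) \sum_(alpha < k.+1)
      \sum_(beta < k.+1 | (alpha, beta) != (ord_max, ord_max))
      lnorm1 (fent (F g) a b alpha beta) *: Sig a b alpha beta.

Definition Kmx (R : realType) (k l p M : nat) (A : 'M[R]_(p, bdim 0 l))
    (Pm : 'M[R]_(bdim 0 l, bdim 0 k.-1 + bdim k l))
    (J : 'M[R]_(bdim 0 k.-1, pdim k M)) : 'M[R]_(p, pdim k M + bdim k l) :=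
  A *m Pm *m block_mx J 0 0 1%:M.

(* T_N^in, where Lam is the matrix whose first pdim k M rows form Pi_M. *)
Definition Tin (R : realType) (k l s q dF M : nat)
    (F : 'rV[R]_s -> 'M[{poly R}]_(k.+1 + k.+1))
    (P Q : 'I_2 -> 'I_2 -> 'I_k.+1 -> 'I_k.+1 -> 'rV[R]_s -> 'M[R]_(pdim k M))
    (Rm : 'I_2 -> 'I_2 -> 'I_k.+1 -> 'I_k.+1 -> 'M[R]_(pdim k M))
    (Sig : 'I_2 -> 'I_2 -> 'I_k.+1 -> 'I_k.+1 -> 'M[R]_2)
    (L : 'M[R]_(dF + dF, pdim k M))
    (Lam : 'M[R]_(pdim k M + bdim k l, q)) : set 'rV[R]_s :=
  [set g | exists Y : auxvars R dF,
     [/\ aux_ok Y,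
         psd (Omegabar M (F g) Y),
         psd ((usubmx Lam)^T *m QM F P Q Rm L g Y *m usubmx Lam) &
         forall x : R, x \in `[-1, 1] ->
           psd (Smx (F g) x - SigmaM F Sig g Y)]].

(* Main.v *)
Require Import Defs.
From HB Require Import structures.
From mathcomp Require Import all_boot all_order all_algebra.
From mathcomp Require Import all_classical all_reals all_analysis.
From mathcomp Require Import zify ring lra.

Set Implicit Arguments.
Unset Strict Implicit.
Unset Printing Implicit Defensive.

Import Order.TTheory GRing.Theory Num.Theory.
Import numFieldNormedType.Exports.

Local Open Scope classical_set_scope.
Local Open Scope ring_scope.

(** Let [g] be in the inner set and [w] in the space [H]; the functional at [w]
    is bounded below by the value of the form [QM] at [psi] plus the integral
    of the form [S - SigmaM] along [(U, V)], and both are nonnegative.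

    The functional is the sum, over all entries of [F], of integrals of an
    entry against two derivatives of [w]. Each derivative is split into a
    Legendre partial sum and a remainder ([int11_split]), which gives [Pcal +
    Qcal + Rcal] ([int11_PQR]). For the pairs of orders other than [(k, k)],
    [Pcal] and [Qcal] are quadratic forms in [psi] and [Rcal] is bounded by
    assumption. For the top order, [Rcal] is kept exactly: it is the integral
    of [S] along the remainders [(U, V)]. The term [Qcal] involves finitely
    many discarded Legendre coefficients, since a polynomial of degree [dF]
    only couples modes at distance at most [dF] ([cross_terms]). It is bounded
    below by positivity of the matrices [Omega], the discarded coefficients
    being absorbed in the integral of the remainders by Bessel's inequality
    ([Omega_bound], [top_order_bound]). Adding up, the quadratic forms in [psi]
    make up [QM], and the constant matrices subtracted from [S] make up
    [SigmaM]. The first form is nonnegative at [psi] because the boundary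
    conditions put [psi] in the range of [usubmx Lam], the second because [S -
    SigmaM] is positive at each point.

    The remainder is defined through the pointwise limit of the Legendre
    series of a derivative, so the splitting rests on the pointwise
    convergence of this series inside the interval ([legendre_cvg]). For a
    continuous function that is differentiable at [x], the error of the
    partial sum at [x] is the integral of the difference quotient at [x]
    against the Christoffel-Darboux kernel ([lsum_error]). It tends to zero
    by Bessel's inequality and the bound [n (1 - x ^ 2) L_n(x) ^ 2 <= 1]
    ([legendre_bound]). All facts on Legendre polynomials are derived from
    Rodrigues' formula. *)

(** * Algebra of the Legendre polynomials *)

Section LegendreAlgebra.
Variable R : realType.
Implicit Types (n : nat) (p : {poly R}).

Let q n : {poly R} := ('X^2 - 1) ^+ n.
(* The normalising constant of Rodrigues' formula, kept as a factor so that
   the identities below are equations between polynomials without division. *)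
Let K n : {poly R} := (2 ^+ n * n`!%:R)%:P.
Local Notation L n := (legendre R n).

Let K_neq0 n : K n != 0.
Proof.
by rewrite polyC_eq0 mulf_neq0 ?expf_neq0 ?pnatr_eq0 -?lt0n ?fact_gt0.
Qed.

Let KS n : K n.+1 = 2 * n.+1%:R * K n.
Proof. by rewrite /K factS natrM exprS !polyCM !polyC_natr; ring. Qed.

Let KL n : K n * L n = (q n)^`(n).
Proof.
by rewrite /K /legendre mul_polyC scalerA divff ?scale1r //.
Qed.

Let deriv_q n : (q n.+1)^`() = (q n * 'X) *+ n.+1 *+ 2.
Proof.
rewrite /q deriv_exp derivB derivXn -polyC1 derivC subr0 /= polyC1.
by rewrite /=; ring.
Qed.

Let derivn_q n j :
  (q n.+1)^`(j.+2) = 2 * n.+1%:R * ((q n)^`(j) *+ j.+1 + (q n)^`(j.+1) * 'X).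
Proof.
have -> : (q n.+1)^`(j.+2) = ((q n.+1)^`())^`(j.+1) by rewrite /derivn iterSr.
rewrite deriv_q !derivnMn -[q n * 'X]addr0 -[X in _ + X]polyC0.
by rewrite derivnMXaddC; ring.
Qed.

Let deriv2_q n :
  (q n.+2)^`()^`() = q n.+1 *+ n.+2 *+ (2 * n.+1).+1 *+ 2
                   + q n *+ n.+1 *+ n.+2 *+ 4.
Proof.
rewrite deriv_q !derivMn derivM derivX deriv_q.
have -> : q n.+1 = ('X^2 - 1) * q n by rewrite /q exprS.
by ring.
Qed.

Let derivK n p : (K n * p)^`() = K n * p^`().
Proof. by rewrite /K mul_polyC derivZ mul_polyC. Qed.

Lemma legendre0 : L 0 = 1.
Proof. by rewrite /legendre /= expr0 mul1r invr1 scale1r. Qed.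

Lemma legendre1 : L 1 = 'X.
Proof.
apply: (mulfI (K_neq0 1)); rewrite KL derivn1 deriv_q /q expr0 mul1r.
by rewrite /K expr1 mulr1 polyC_natr mulr1n mulr_natl.
Qed.

(** One derivative of the power [('X^2 - 1) ^+ n.+1] in Rodrigues' formula
    brings out a single factor ['X], so in Leibniz' rule for the remaining
    derivatives only two terms survive. *)
Lemma deriv_legendreS n : (L n.+1)^`() = 'X * (L n)^`() + n.+1%:R * L n.
Proof.
apply: (mulfI (K_neq0 n.+1)); rewrite -derivK KL -derivnS derivn_q.
rewrite -KL derivnS -KL derivK KS.
by ring.
Qed.

(** Two derivatives of [('X^2 - 1) ^+ n.+2] produce a factor ['X^2], which
    is rewritten as [('X^2 - 1) + 1]: this leaves two lower powers and no
    variable coefficient. *)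
Lemma deriv_legendreSS n :
  (L n.+2)^`() = (L n)^`() + (2 * n.+1 + 1)%:R * L n.+1.
Proof.
apply: (mulfI (K_neq0 n.+2)); rewrite -derivK KL -derivnS.
have -> : (q n.+2)^`(n.+3) = ((q n.+2)^`()^`())^`(n.+1).
  by rewrite /derivn !iterSr.
rewrite deriv2_q derivnD !derivnMn -KL derivnS -KL derivK !KS.
by ring.
Qed.

Lemma mulX_deriv_legendreS n :
  'X * (L n.+1)^`() = (L n)^`() + n.+1%:R * L n.+1.
Proof.
apply: (addIr (n.+2%:R * L n.+1)); rewrite -deriv_legendreS deriv_legendreSS.
by ring.
Qed.

Let legendre_ode1' n :
  (1 - 'X^2) * (L n.+1)^`() = n.+1%:R * (L n - 'X * L n.+1).
Proof.
have h1 := deriv_legendreS n; have h2 := mulX_deriv_legendreS n.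
rewrite mulrBl mul1r {1}h1 expr2 -mulrA h2; ring.
Qed.

(** Eliminating the derivatives between the two differentiation formulas
    gives the three-term recurrence multiplied by ['X], which can be
    cancelled. *)
Lemma legendre_rec n :
  n.+2%:R * L n.+2 = (2 * n + 3)%:R * 'X * L n.+1 - n.+1%:R * L n.
Proof.
have h1 := legendre_ode1' n.+1; have h2 := legendre_ode1' n.
have h3 := deriv_legendreS n.+1.
have X0 : 'X != 0 :> {poly R} by rewrite polyX_eq0.
apply: (mulfI X0).
rewrite h3 mulrDr [X in X + _](_ : _ = 'X * ((1 - 'X^2) * (L n.+1)^`())) in h1.
  rewrite h2 in h1.
  have -> : 'X * (n.+2%:R * L n.+2)
          = n.+2%:R * L n.+1 - n.+2%:R * (L n.+1 - 'X * L n.+2) by ring.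
  by rewrite -h1; ring.
by ring.
Qed.

Lemma legendre_ode1 n :
  ('X^2 - 1) * (L n)^`() = n.+1%:R * (L n.+1 - 'X * L n).
Proof.
case: n => [|n].
  by rewrite legendre0 legendre1 -polyC1 derivC polyC1; ring.
have h1 := legendre_ode1' n; have h2 := legendre_rec n.
rewrite mulrBr h2 -[_ - 1]opprB mulNr h1;ring.
Qed.

Lemma legendre_ode n :
  (('X^2 - 1) * (L n)^`())^`() = (n * n.+1)%:R * L n.
Proof.
rewrite legendre_ode1 -polyC_natr mul_polyC derivZ -mul_polyC polyC_natr.
by rewrite derivB deriv_legendreS derivM derivX; ring.
Qed.

Lemma horner_natr (k : nat) (x : R) : (k%:R : {poly R}).[x] = k%:R.
Proof. by rewrite -polyC_natr hornerC. Qed.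

Lemma legendre_hornerS n (x : R) :
  n.+2%:R * (L n.+2).[x]
  = (2 * n + 3)%:R * x * (L n.+1).[x] - n.+1%:R * (L n).[x].
Proof.
have := congr1 (fun p => p.[x]) (legendre_rec n).
by rewrite hornerM horner_natr => ->; rewrite hornerD hornerN !hornerM
  !horner_natr hornerX.
Qed.

(** Multiplied by [x - t], the kernel telescopes by the three-term
    recurrence. *)
Lemma christoffel_darboux n (x t : R) :
  (x - t) * \sum_(i < n.+1) (2 * i + 1)%:R * (L i).[x] * (L i).[t]
  = n.+1%:R * ((L n.+1).[x] * (L n).[t] - (L n).[x] * (L n.+1).[t]).
Proof.
elim: n => [|n IH].
  by rewrite big_ord1 legendre0 legendre1 !hornerX !hornerC /=; ring.
rewrite big_ord_recr /= mulrDr IH.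
have hx := legendre_hornerS n x; have ht := legendre_hornerS n t.
rewrite [RHS](_ : _ = n.+2%:R * (L n.+2).[x] * (L n.+1).[t]
                      - (L n.+1).[x] * (n.+2%:R * (L n.+2).[t])); last by ring.
rewrite hx ht.
by ring.
Qed.

End LegendreAlgebra.

(** * Continuous functions and their integrals over the segment *)

Section Integral.
Variable R : realType.
Implicit Types (f g h : R -> R) (p : {poly R}).

Local Notation mu := (@lebesgue_measure R).
Local Notation cont f := ({within `[(-1 : R), 1], continuous (f : R -> R)}).

Let integrable_cont f : cont f -> mu.-integrable `[-1, 1] (EFin \o f).
Proof.
move=> cf; apply: continuous_compact_integrable => //.
exact: segment_compact.
Qed.

Lemma cont_poly p : cont (horner p).
Proof. by apply: continuous_subspaceT; exact: continuous_horner. Qed.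

Lemma cont_cst (c : R) : cont (fun=> c).
Proof. by apply: continuous_subspaceT => x; exact: cvg_cst. Qed.

Lemma contD f g : cont f -> cont g -> cont (fun x => f x + g x).
Proof. by move=> cf cg x; apply: cvgD; [exact: cf|exact: cg]. Qed.

Lemma contB f g : cont f -> cont g -> cont (fun x => f x - g x).
Proof. by move=> cf cg x; apply: cvgB; [exact: cf|exact: cg]. Qed.

Lemma contM f g : cont f -> cont g -> cont (fun x => f x * g x).
Proof. by move=> cf cg x; apply: cvgM; [exact: cf|exact: cg]. Qed.

Lemma cont_sum (I : Type) (r : seq I) (P : pred I) (F : I -> R -> R) :
  (forall i, P i -> cont (F i)) -> cont (fun x => \sum_(i <- r | P i) F i x).
Proof.
move=> cF; elim: r => [|i r IH].
  rewrite (_ : (fun _ => _) = fun=> 0); first exact: cont_cst.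
  by apply/funext => x; rewrite big_nil.
case Pi : (P i); last first.
  rewrite (_ : (fun _ => _) = fun x => \sum_(i <- r | P i) F i x) //.
  by apply/funext => x; rewrite big_cons Pi.
rewrite (_ : (fun _ => _) = fun x => F i x + \sum_(i <- r | P i) F i x).
  by apply: contD => //; exact: cF.
by apply/funext => x; rewrite big_cons Pi.
Qed.

Lemma eq_int11 f g : (forall x, x \in `[-1, 1] -> f x = g x) ->
  int11 f = int11 g.
Proof.
by move=> fg; apply: eq_Rintegral => x; rewrite inE; exact: fg.
Qed.

Lemma int11D f g : cont f -> cont g ->
  int11 (fun x => f x + g x) = int11 f + int11 g.
Proof. by move=> cf cg; apply: RintegralD => //; exact: integrable_cont. Qed.

Lemma int11Z c f : cont f -> int11 (fun x => c * f x) = c * int11 f.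
Proof. by move=> cf; apply: RintegralZl => //; exact: integrable_cont. Qed.

Lemma int11B f g : cont f -> cont g ->
  int11 (fun x => f x - g x) = int11 f - int11 g.
Proof. by move=> cf cg; apply: RintegralB => //; exact: integrable_cont. Qed.

Lemma int11_sum (I : Type) (r : seq I) (P : pred I) (F : I -> R -> R) :
  (forall i, P i -> cont (F i)) ->
  int11 (fun x => \sum_(i <- r | P i) F i x) = \sum_(i <- r | P i) int11 (F i).
Proof.
move=> cF; elim: r => [|i r IH].
  rewrite big_nil -[RHS](mul0r (int11 (fun=> 0))) -int11Z; last exact: cont_cst.
  by apply: eq_int11 => x _; rewrite big_nil mul0r.
rewrite big_cons -IH; case Pi : (P i); last first.
  by apply: eq_int11 => x _; rewrite big_cons Pi.
rewrite -int11D; [|exact: cF|exact: cont_sum].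
by apply: eq_int11 => x _; rewrite big_cons Pi.
Qed.

Lemma int11_ge0 f : (forall x, x \in `[-1, 1] -> 0 <= f x) -> 0 <= int11 f.
Proof. by move=> f0; apply: Rintegral_ge0 => x xI; apply: f0. Qed.

(** The endpoints form a null set: convergence of Legendre series is needed
    in the open interval only. *)
Lemma int11_oo f g : cont g -> (forall x, x \in `]-1, 1[ -> f x = g x) ->
  int11 f = int11 g.
Proof.
move=> cg fg.
have mg : measurable_fun `](-1 : R), 1[ g.
  apply: (@measurable_funS _ _ _ _ `[(-1 : R), 1]) => //.
    exact: subset_itv_oo_cc.
  exact: measurable_realfun.subspace_continuous_measurable_fun.
have mf : measurable_fun `](-1 : R), 1[ f.
  by apply: eq_measurable_fun mg => x; rewrite inE => /fg ->.
by rewrite /int11 /Rintegral (eq_integral_itv_bounded true false mf mg).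
Qed.

Lemma int11_deriv p : int11 (horner p^`()) = p.[1] - p.[-1].
Proof.
rewrite /int11 /Rintegral (@continuous_FTC2 _ _ (horner p)) //.
- exact: cont_poly.
- split; first by move=> x _; exact: derivable_horner.
  + by apply: cvg_at_right_filter; exact: continuous_horner.
  + by apply: cvg_at_left_filter; exact: continuous_horner.
- by move=> x _; rewrite -derivE.
Qed.

(** At [x] the extended quotient takes the value of the derivative. *)
Lemma cont_diff_quotient f x : cont f ->
  cvg ((fun y => (f y - f x) / (y - x)) @ within `[-1, 1] x^') ->
  exists2 g : R -> R, cont g & forall t, f t - f x = g t * (t - x).
Proof.
move=> cf cd; set d := lim _ in cd.
exists (fun t => if t == x then d else (f t - f x) / (t - x)); last first.
  move=> t; case: eqVneq => [->|tx]; first by rewrite !subrr mulr0.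
  by rewrite divfK // subr_eq0.
apply/subspace_continuousP => t tI.
have [->|tx] := eqVneq t x.
  move=> B; rewrite /from_subspace eqxx => dB; have Bd := nbhs_singleton dB.
  have H : \forall s \near x, s != x -> `[(-1 : R), 1]%classic s ->
      B ((f s - f x) / (s - x)) := cd B dB.
  suff : \forall s \near x, `[(-1 : R), 1]%classic s ->
      B (if s == x then d else (f s - f x) / (s - x)) by [].
  by apply: filterS H => s Hs sI; case: eqVneq => [//|sx]; exact: Hs.
have tx0 : t - x != 0 by rewrite subr_eq0.
have ctf : f s @[s --> within `[-1, 1] (nbhs t)] --> f t.
  by move/subspace_continuousP : cf; apply.
have cvgid : s @[s --> within `[-1, 1] (nbhs t)] --> t.
  exact: cvg_within.
apply: (@cvg_trans _ ((fun s => (f s - f x) / (s - x))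
                        @ within `[-1, 1] (nbhs t))).
  apply: near_eq_cvg; apply: cvg_within.
  have : \forall s \near t, s != x.
    by apply: open_nbhs_nbhs; split => //; exact: open_neq.
  by apply: filterS => s /negbTE sx; rewrite /from_subspace sx.
rewrite /from_subspace (negbTE tx).
apply: cvgM; first by apply: cvgB => //; exact: cvg_cst.
by apply: cvgV => //; apply: cvgB => //; exact: cvg_cst.
Qed.

End Integral.

(** * Orthogonality, Legendre sums and Bessel's inequality *)

Section LegendreSeries.
Variable R : realType.
Implicit Types (f g h r : R -> R) (p q : {poly R}) (n i j : nat) (x : R).

Local Notation L n := (legendre R n).
Local Notation cont f := ({within `[(-1 : R), 1], continuous (f : R -> R)}).

Lemma contMpoly f p : cont f -> cont (fun x => f x * p.[x]).
Proof. by move=> cf; apply: contM => //; exact: cont_poly. Qed.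

Lemma horner_X2B1M x p : x ^+ 2 = 1 -> (('X^2 - 1) * p).[x] = 0.
Proof.
by move=> x2; rewrite hornerM hornerD hornerN hornerXn hornerC x2 subrr mul0r.
Qed.

(** By the Legendre equation, [(n (n + 1) - m (m + 1)) L_n L_m] is the
    derivative of [('X^2 - 1) (L_n' L_m - L_n L_m')], which vanishes at both
    endpoints. *)
Lemma int11_legendre_neq n m : n != m ->
  int11 (fun x => (L n).[x] * (L m).[x]) = 0.
Proof.
move=> nm; pose c : R := (n * n.+1)%:R - (m * m.+1)%:R.
have c0 : c != 0.
  rewrite subr_eq0 eqr_nat; apply: contra nm => /eqP e.
  by rewrite eqn_leq; apply/andP; split; rewrite leqNgt; apply/negP => l; nia.
pose W := ('X^2 - 1) * (L n)^`(); pose V := ('X^2 - 1) * (L m)^`().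
have := int11_deriv (W * L m - L n * V).
have -> : (W * L m - L n * V)^`() = c%:P * (L n * L m).
  rewrite derivB (derivM W) (derivM _ V) !legendre_ode polyCB !polyC_natr /W /V.
  by ring.
rewrite !hornerD !hornerN !(hornerM W) !(hornerM _ V) !horner_X2B1M ?sqrrN
  ?expr1n //.
rewrite !mul0r !mulr0 !subrr => h; apply: (mulfI c0); rewrite mulr0 -[RHS]h.
rewrite -int11Z; first by apply: eq_int11 => x _; rewrite !hornerM hornerC.
by apply: contMpoly; exact: cont_poly.
Qed.

Lemma legendre_horner_rec n x :
  n.+1%:R * (L n.+1).[x]
  = (2 * n + 1)%:R * x * (L n).[x] - n%:R * (L n.-1).[x].
Proof.
case: n => [|n]; last first.
  by rewrite legendre_hornerS /=; congr (_%:R * _ * _ - _); lia.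
by rewrite legendre0 legendre1 hornerX hornerC /=; ring.
Qed.

(** The integral of [x L_n L_(n + 1)] is computed by the recurrence for
    [L_(n + 1)] and by the one for [L_(n + 2)]; comparing the two relates
    the norms of [L_n] and [L_(n + 1)]. *)
Lemma int11_legendre_sqr n :
  int11 (fun x => (L n).[x] * (L n).[x]) = 2 / (2 * n + 1)%:R.
Proof.
elim: n => [|n IH].
  have := int11_deriv ('X : {poly R}).
  rewrite derivX !hornerX opprK => h; rewrite divr1 -[RHS]h.
  by apply: eq_int11 => x _; rewrite legendre0 !hornerC mulr1.
set X := int11 (fun x => x * (L n).[x] * (L n.+1).[x]).
have cX : cont (fun x => x * (L n).[x] * (L n.+1).[x]).
  do 2!apply: contMpoly; rewrite (_ : id = horner 'X) //.
    exact: cont_poly.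
  by apply/funext => x; rewrite hornerX.
have cL k l : cont (fun x => (L k).[x] * (L l).[x]).
  by apply: contMpoly; exact: cont_poly.
have e1 : n.+1%:R * int11 (fun x => (L n.+1).[x] * (L n.+1).[x])
          = (2 * n + 1)%:R * X.
  rewrite -!int11Z // -[RHS]subr0 -[X in _ - X](mulr0 n%:R).
  rewrite -(@int11_legendre_neq n.-1 n.+1); last by lia.
  rewrite -int11Z // -int11B; last 2 first.
  - by apply: contM => //; exact: cont_cst.
  - by apply: contM => //; exact: cont_cst.
  apply: eq_int11 => x _; rewrite [LHS]mulrA legendre_horner_rec; ring.
have e2 : (2 * n + 3)%:R * X
          = n.+1%:R * int11 (fun x => (L n).[x] * (L n).[x]).
  rewrite -!int11Z // -[LHS]subr0 -[X in _ - X](mulr0 n.+2%:R).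
  rewrite -(@int11_legendre_neq n n.+2); last by lia.
  rewrite -int11Z // -int11B; last 2 first.
  - by apply: contM => //; exact: cont_cst.
  - by apply: contM => //; exact: cont_cst.
  apply: eq_int11 => x _; rewrite [X in _ - X](_ : _ =
    (L n).[x] * (n.+2%:R * (L n.+2).[x])); last by ring.
  by rewrite legendre_hornerS; ring.
rewrite IH in e2.
have n1 : n.+1%:R != 0 :> R by rewrite pnatr_eq0.
have n2 : (2 * n + 1)%:R != 0 :> R by rewrite pnatr_eq0 addn1.
have n3 : (2 * n + 3)%:R != 0 :> R by rewrite pnatr_eq0 addn3.
have -> : (2 * n.+1 + 1 = 2 * n + 3)%N by lia.
apply: (mulfI n1); rewrite e1; apply: (mulfI n3).
by rewrite mulrCA e2 ![_ * (n.+1%:R * _)]mulrCA ![_ * (2 / _)]mulrC !divfK.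
Qed.

(** By the recurrence, multiplication by the variable moves a Legendre index
    by at most one, so each degree of [p] costs one index of orthogonality. *)
Lemma int11_poly_legendre_orth N r p i : cont r ->
  (forall j, (j <= N)%N -> int11 (fun x => r x * (L j).[x]) = 0) ->
  (size p + i <= N.+1)%N ->
  int11 (fun x => r x * (p.[x] * (L i).[x])) = 0.
Proof.
move=> cr rL.
have mono j : forall i, (j + i <= N)%N ->
    int11 (fun x => r x * ('X^j * L i).[x]) = 0.
  elim: j => [|j IH] {}i ji.
    rewrite -[RHS](rL i) //; apply: eq_int11 => x _.
    by rewrite expr0 mul1r.
  have n2 : (2 * i + 1)%:R != 0 :> R by rewrite pnatr_eq0 addn1.
  apply: (mulfI n2); rewrite mulr0 -[RHS](addr0 0).
  rewrite -[X in _ = X + _](mulr0 i.+1%:R) -[X in _ = _ + X](mulr0 i%:R).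
  rewrite -[in X in _ = X + _](IH i.+1); last by lia.
  rewrite -[in X in _ = _ + X](IH i.-1); last by lia.
  rewrite -!int11Z; try exact: contMpoly.
  rewrite -int11D; last 2 first.
  - by apply: contM; [exact: cont_cst|exact: contMpoly].
  - by apply: contM; [exact: cont_cst|exact: contMpoly].
  apply: eq_int11 => x _; rewrite !hornerM !hornerXn exprS.
  rewrite [X in _ = X + _](_ : _ =
    r x * x ^+ j * (i.+1%:R * (L i.+1).[x])); last by ring.
  by rewrite legendre_horner_rec; ring.
move=> pi.
rewrite (_ : int11 _ = int11 (fun x =>
  \sum_(j < size p) p`_j * (r x * ('X^j * L i).[x]))); last first.
  apply: eq_int11 => x _; rewrite horner_coef mulr_suml mulr_sumr.
  by apply: eq_bigr => j _; rewrite hornerM hornerXn; ring.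
rewrite int11_sum => [|j _]; last first.
  by apply: contM; [exact: cont_cst|exact: contMpoly].
rewrite big1 // => j _; rewrite int11Z; last exact: contMpoly.
by rewrite mono ?mulr0 //; have := ltn_ord j; lia.
Qed.

Definition lsum h n : {poly R} := \sum_(i < n) lcoef h i *: L i.

Definition lrem h n x : R := h x - (lsum h n).[x].

Lemma lsumE h n x : (lsum h n).[x] = \sum_(i < n) lcoef h i * (L i).[x].
Proof. by rewrite horner_sum; apply: eq_bigr => i _; rewrite hornerZ. Qed.

Lemma cont_lrem h n : cont h -> cont (lrem h n).
Proof. by move=> ch; apply: contB => //; exact: cont_poly. Qed.

Lemma int11_lcoef h i :
  int11 (fun x => h x * (L i).[x]) = 2 / (2 * i + 1)%:R * lcoef h i.
Proof.
have n2 : (2 * i + 1)%:R != 0 :> R by rewrite pnatr_eq0 addn1.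
by rewrite /lcoef; field.
Qed.

Lemma int11_lsum_legendre h n i :
  int11 (fun x => (lsum h n).[x] * (L i).[x])
  = if (i < n)%N then 2 / (2 * i + 1)%:R * lcoef h i else 0.
Proof.
have cL j : cont (fun x => lcoef h j * ((L j).[x] * (L i).[x])).
  by apply: contM; [exact: cont_cst|apply: contMpoly; exact: cont_poly].
rewrite (_ : int11 _ = int11 (fun x =>
  \sum_(j < n) lcoef h j * ((L j).[x] * (L i).[x]))); last first.
  by apply: eq_int11 => x _; rewrite lsumE mulr_suml; apply: eq_bigr => j _;
    rewrite mulrA.
rewrite int11_sum // (eq_bigr (fun j : 'I_n => if j == i :> nat then
  2 / (2 * i + 1)%:R * lcoef h i else 0)); last first.
  move=> j _; rewrite int11Z; last by apply: contMpoly; exact: cont_poly.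
  case: eqP => [->|/eqP ji]; last by rewrite int11_legendre_neq // mulr0.
  by rewrite int11_legendre_sqr mulrC.
rewrite -big_mkcond /=; case: ifP => [lt|ge].
  by rewrite (big_pred1 (Ordinal lt)).
rewrite big_pred0 // => j; apply/negP => /eqP e.
by move: (ltn_ord j); rewrite e ge.
Qed.

Lemma int11_lrem_legendre h n i : cont h ->
  int11 (fun x => lrem h n x * (L i).[x])
  = if (i < n)%N then 0 else 2 / (2 * i + 1)%:R * lcoef h i.
Proof.
move=> ch; rewrite (_ : int11 _ = int11 (fun x =>
  h x * (L i).[x] - (lsum h n).[x] * (L i).[x])); last first.
  by apply: eq_int11 => x _; rewrite mulrBl.
rewrite int11B; [|exact: contMpoly|by apply: contMpoly; exact: cont_poly].
by rewrite int11_lcoef int11_lsum_legendre; case: ifP; rewrite ?subrr ?subr0.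
Qed.

Lemma lcoef_lrem h n i : cont h ->
  lcoef (lrem h n) i = if (i < n)%N then 0 else lcoef h i.
Proof.
have n2 : (2 * i + 1)%:R != 0 :> R by rewrite pnatr_eq0 addn1.
move=> ch; rewrite /lcoef int11_lrem_legendre // /lcoef.
by case: ifP => _; rewrite ?mulr0 //; field.
Qed.

(** Bessel's inequality: the squared norm of the remainder is nonnegative. *)
Lemma bessel h n : cont h ->
  \sum_(i < n) 2 / (2 * i + 1)%:R * lcoef h i ^+ 2
  <= int11 (fun x => h x * h x).
Proof.
move=> ch; have cr : cont (lrem h n) by exact: cont_lrem.
have : 0 <= int11 (fun x => lrem h n x * lrem h n x).
  by apply: int11_ge0 => x _; rewrite -expr2 sqr_ge0.
rewrite (_ : int11 _ = int11 (fun x => h x * h x - \sum_(i < n)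
    lcoef h i * (h x * (L i).[x]) - \sum_(i < n)
    lcoef h i * (lrem h n x * (L i).[x]))); last first.
  apply: eq_int11 => x _; rewrite {1 2}/lrem.
  rewrite (_ : \sum_(i < n) lcoef h i * (h x * _) = h x * (lsum h n).[x]).
    rewrite (_ : \sum_(i < n) _ = lrem h n x * (lsum h n).[x]).
      by rewrite /lrem; ring.
    by rewrite lsumE mulr_sumr; apply: eq_bigr => i _; ring.
  by rewrite lsumE mulr_sumr; apply: eq_bigr => i _; ring.
have c1 i : cont (fun x => lcoef h i * (h x * (L i).[x])).
  by apply: contM; [exact: cont_cst|exact: contMpoly].
have c2 i : cont (fun x => lcoef h i * (lrem h n x * (L i).[x])).
  by apply: contM; [exact: cont_cst|exact: contMpoly].
have chh : cont (fun x => h x * h x) by exact: contM.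
rewrite int11B; [|by apply: contB => //; exact: cont_sum|exact: cont_sum].
rewrite int11B //; last exact: cont_sum.
rewrite !int11_sum // [X in _ - X]big1; last first.
  move=> i _; rewrite int11Z; last exact: contMpoly.
  by rewrite int11_lrem_legendre // ltn_ord mulr0.
rewrite subr0 subr_ge0; apply: le_trans; rewrite le_eqVlt; apply/orP; left.
apply/eqP; apply: eq_bigr => i _; rewrite int11Z; last exact: contMpoly.
by rewrite int11_lcoef; ring.
Qed.

(** Bessel's inequality for the remainder, whose first [n] coefficients
    vanish. *)
Lemma bessel_tail h n d : cont h ->
  \sum_(i < d) 2 / (2 * (n + i) + 1)%:R * lcoef h (n + i) ^+ 2
  <= int11 (fun x => lrem h n x * lrem h n x).
Proof.
move=> ch.
apply: le_trans (@bessel (lrem h n) (n + d) _); last exact: cont_lrem.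
rewrite big_split_ord /= [X in _ <= X + _]big1 ?add0r; last first.
  by move=> i _; rewrite lcoef_lrem //= ltn_ord expr0n mulr0.
rewrite le_eqVlt; apply/orP; left; apply/eqP; apply: eq_bigr => i _.
by rewrite lcoef_lrem //= ltnNge leq_addr.
Qed.

End LegendreSeries.

(** * Pointwise convergence of Legendre series *)

Section LegendreConvergence.
Variable R : realType.
Implicit Types (f g h : R -> R) (p q : {poly R}) (n i j : nat) (x : R).

Local Notation L n := (legendre R n).
Local Notation cont f := ({within `[(-1 : R), 1], continuous (f : R -> R)}).

Lemma poly_min0 p q x : p^`() = 'X * q -> (forall y, 0 <= q.[y]) ->
  p.[0] <= p.[x].
Proof.
move=> dp q0.
have dE y : (horner p)^`()%classic y = y * q.[y].
  by rewrite -derivE dp hornerM hornerX.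
have [x0|/ltW x0] := leP 0 x.
  apply: (@ger0_derive1_ndecr _ (horner p) 0 x) => //.
  - by move=> y; rewrite in_itv /= => /andP[/ltW y0 _]; rewrite dE mulr_ge0.
  - by apply: continuous_subspaceT; exact: continuous_horner.
apply: (@ler0_derive1_nincr _ (horner p) x 0) => //.
- by move=> y; rewrite in_itv /= => /andP[_ /ltW y0]; rewrite dE mulr_le0_ge0.
- by apply: continuous_subspaceT; exact: continuous_horner.
Qed.

(** Sonin's argument. Let [E = n (n + 1) L_n ^ 2 + (1 - x ^ 2) L_n' ^ 2]. By
    the Legendre equation [E' = 2 x L_n' ^ 2], so [E] is minimal at [0] and
    [E 0] is at most the mean of [E], which is less than [n + 1]. On the
    other hand the derivative of [(1 - x ^ 2) E] is [- 2 n (n + 1) x L_n ^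
    2], so this function is maximal at [0], where it equals [E 0]. *)
Lemma legendre_bound n x : x \in `[-1, 1] ->
  n%:R * ((1 - x ^+ 2) * (L n).[x] ^+ 2) <= 1.
Proof.
rewrite in_itv /= => /andP[x1 x2].
have [->|n0] := posnP n; first by rewrite mul0r.
pose W : {poly R} := ('X^2 - 1) * (L n)^`().
have dW : W^`() = (n * n.+1)%:R * L n by exact: legendre_ode.
have dW' : W^`() = 'X *+ 2 * (L n)^`() + ('X^2 - 1) * (L n)^`()^`().
  by rewrite derivM derivB derivXn -polyC1 derivC subr0 /= expr1 polyC1.
pose E : {poly R} := (n * n.+1)%:R * L n ^+ 2 - W * (L n)^`().
have dE : E^`() = 'X * (2%:R * (L n)^`() ^+ 2).
  rewrite /E derivB derivM (derivM W) -polyC_natr derivC polyC_natr.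
  rewrite expr2 derivM mul0r add0r.
  rewrite [W * _](_ : _ = (L n)^`() * (('X^2 - 1) * (L n)^`()^`()));
    last by rewrite /W; ring.
  rewrite (_ : ('X^2 - 1) * _ = W^`() - 'X *+ 2 * (L n)^`());
    last by rewrite dW'; ring.
  by rewrite dW; ring.
(* The opposite of [(1 - x ^ 2) E], so that it is minimal at 0 as well. *)
pose G : {poly R} := ('X^2 - 1) * E.
have dG : G^`() = 'X * ((2 * (n * n.+1))%:R * L n ^+ 2).
  rewrite /G derivM dE derivB derivXn -polyC1 derivC subr0 /= expr1 polyC1.
  by rewrite /E /W; ring.
have sqr_nat_ge0 k p y : 0 <= (k%:R * p ^+ 2).[y].
  by rewrite hornerM horner_natr horner_exp mulr_ge0 // sqr_ge0.
have GE y : G.[y] = (y ^+ 2 - 1) * E.[y].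
  by rewrite hornerM hornerD hornerN hornerXn hornerC.
have EE y : E.[y] = (n * n.+1)%:R * (L n).[y] ^+ 2
                    + (1 - y ^+ 2) * (L n)^`().[y] ^+ 2.
  rewrite hornerD hornerN hornerM horner_natr horner_exp (hornerM W) hornerM.
  by rewrite hornerD hornerN hornerXn hornerC; ring.
have meanE : int11 (horner E) = 2 * ((n * n.+1)%:R * (2 / (2 * n + 1)%:R)).
  have cL : cont (fun y => (L n).[y] * (L n).[y]).
    by apply: contMpoly; exact: cont_poly.
  have := int11_deriv (W * L n).
  rewrite !(hornerM W) !horner_X2B1M ?sqrrN ?expr1n // !mul0r subrr => h0.
  rewrite -[LHS]addr0 -[X in _ + X]h0 -int11D; [|exact: cont_poly..].
  rewrite -int11_legendre_sqr -!int11Z //; last first.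
    by apply: contM => //; exact: cont_cst.
  apply: eq_int11 => y _; rewrite (derivM W) dW (hornerD (_ * L n)) /E hornerD.
  by rewrite hornerN !(hornerM W) !hornerM horner_natr; ring.
have E0 : 2 * E.[0] <= int11 (horner E).
  have <- : int11 (fun=> E.[0]) = 2 * E.[0].
    have := int11_deriv (E.[0]%:P * 'X).
    rewrite derivM derivX derivC mul0r add0r !hornerM !hornerC !hornerX !mulr1.
    rewrite mulrN opprK ?mulr1 => h1; rewrite mulr_natl mulr2n -h1.
    by apply: eq_int11 => y _; rewrite hornerC.
  rewrite -subr_ge0 -int11B; [|exact: cont_poly|exact: cont_cst].
  apply: int11_ge0 => y _; rewrite subr_ge0.
  by apply: poly_min0 dE _ => z; exact: sqr_nat_ge0.
have G0 : G.[0] <= G.[x].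
  by apply: poly_min0 dG _ => z; exact: sqr_nat_ge0.
have n1 : 0 < n%:R * n.+1%:R :> R by rewrite mulr_gt0 ?ltr0n.
rewrite -(ler_pM2l n1) mulr1.
have n2 : (2 * n + 1)%:R = 2 * n%:R + 1 :> R by rewrite natrD natrM.
have nn1 : n.+1%:R = n%:R + 1 :> R by rewrite -natr1.
have n0' : 0 < n%:R :> R by rewrite ltr0n.
rewrite meanE in E0.
have E0' : E.[0] <= n%:R + 1.
  rewrite -(ler_pM2l (ltr0n _ 2 : 0 < 2%:R :> R)); apply: le_trans E0 _.
  rewrite ler_pM2l // mulrA.
  by rewrite ler_pdivrMr ?n2 ?natrM ?nn1; nra.
rewrite !GE (EE x) natrM in G0.
have x3 : 0 <= 1 - x ^+ 2 by nra.
have x4 : 0 <= (1 - x ^+ 2) * ((1 - x ^+ 2) * (L n)^`().[x] ^+ 2).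
  by apply: mulr_ge0 => //; apply: mulr_ge0 => //; exact: sqr_ge0.
have : n%:R * n.+1%:R * ((1 - x ^+ 2) * (L n).[x] ^+ 2) <= n%:R + 1.
  by rewrite expr0n /= in G0; lra.
by rewrite nn1 => h; nra.
Qed.

(** The kernel of the partial sum has integral [1], so the error is the
    integral of [h t - h x] against it; the factor [t - x] of this
    difference brings the kernel into its Christoffel-Darboux form. *)
Lemma lsum_error h g x n : cont h -> cont g ->
  (forall t, h t - h x = g t * (t - x)) ->
  h x - (lsum h n.+1).[x]
  = n.+1%:R / 2 * ((L n.+1).[x] * int11 (fun t => g t * (L n).[t])
                   - (L n).[x] * int11 (fun t => g t * (L n.+1).[t])).
Proof.
move=> ch cg hg.
have chB : cont (fun t => h t - h x) by apply: contB => //; exact: cont_cst.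
have -> : h x - (lsum h n.+1).[x]
  = - \sum_(i < n.+1) (2 * i + 1)%:R / 2 * (L i).[x]
        * int11 (fun t => (h t - h x) * (L i).[t]).
  rewrite (eq_bigr (fun i : 'I_n.+1 => lcoef h i * (L i).[x]
    - (2 * i + 1)%:R / 2 * (L i).[x] * h x * int11 (horner (L i)))); last first.
    move=> i _; rewrite (_ : int11 (fun t => _ * _) =
      int11 (fun t => h t * (L i).[t] - h x * (L i).[t])); last first.
      by apply: eq_int11 => t _; rewrite mulrBl.
    have cL : cont (fun t => h x * (L i).[t]).
      by apply: contMpoly; exact: cont_cst.
    rewrite int11B // ?int11Z; [|exact: cont_poly|exact: contMpoly].
    by rewrite /lcoef; ring.
  rewrite sumrB -lsumE big_ord_recl big1 => [|i _]; last first.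
    rewrite [int11 _](_ : _ =
      int11 (fun t => (L 0).[t] * (L (lift ord0 i)).[t])).
      by rewrite int11_legendre_neq // mulr0.
    by apply: eq_int11 => t _; rewrite legendre0 hornerC mul1r.
  rewrite [int11 _](_ : _ = int11 (fun t => (L 0).[t] * (L 0).[t])).
    by rewrite int11_legendre_sqr legendre0 hornerC /=; field.
  by apply: eq_int11 => t _; rewrite legendre0 hornerC mul1r.
have cgL i c : cont (fun t => c * (g t * (L i).[t])).
  by apply: contM; [exact: cont_cst|exact: contMpoly].
rewrite (eq_bigr (fun i : 'I_n.+1 => int11 (fun t => (2 * i + 1)%:R / 2
    * (L i).[x] * ((h t - h x) * (L i).[t])))); last first.
  by move=> i _; rewrite int11Z //; exact: contMpoly.
rewrite -int11_sum => [|i _]; last first.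
  by apply: contM; [exact: cont_cst|exact: contMpoly].
rewrite mulrBr !mulrA -!int11Z; [|exact: contMpoly..].
rewrite -int11B // -mulN1r -int11Z; last first.
  apply: cont_sum => i _.
  by apply: contM; [exact: cont_cst|exact: contMpoly].
apply: eq_int11 => t _.
rewrite (eq_bigr (fun i : 'I_n.+1 => (g t * (t - x) / 2) *
  ((2 * i + 1)%:R * (L i).[x] * (L i).[t]))); last first.
  by move=> i _; rewrite hg; field.
rewrite -mulr_sumr.
rewrite (_ : -1 * _ = g t / 2 * ((x - t) * \sum_(i < n.+1)
  (2 * i + 1)%:R * (L i).[x] * (L i).[t])); last by ring.
by rewrite christoffel_darboux; ring.
Qed.

(** In the error formula the two integrals are Legendre coefficients of a
    continuous function [g], so by Bessel they are [o(n ^ (-1/2))]; by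
    [legendre_bound] the Legendre polynomials at [x] are [O(n ^ (-1/2))].
    These two decays compensate the factor [n + 1]. *)
Lemma legendre_cvg h x : cont h -> x \in `]-1, 1[ ->
  cvg ((fun y => (h y - h x) / (y - x)) @ within `[-1, 1] x^') ->
  (lsum h n).[x] @[n --> \oo] --> h x.
Proof.
move=> ch xI /(cont_diff_quotient ch) [g cg hg].
have xI' : x \in `[-1, 1] by exact: subset_itv_oo_cc xI.
have w0 : 0 < 1 - x ^+ 2 by move: xI; rewrite in_itv /= => /andP[? ?]; nra.
(* The terms of Bessel's series for the difference quotient. *)
pose b i := 2 / (2 * i + 1)%:R * lcoef g i ^+ 2.
have b_ge0 i : 0 <= b i by rewrite /b mulr_ge0 ?sqr_ge0 ?divr_ge0.
have b_cvg : b n @[n --> \oo] --> 0.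
  apply: cvg_series_cvg_0; apply: nondecreasing_is_cvgn.
    apply/nondecreasing_seqP => i.
    by rewrite seriesEord /= big_ord_recr /= lerDl.
  exists (int11 (fun t => g t * g t)) => _ [i _ <-].
  by rewrite seriesEord /=; exact: bessel.
set w := 1 - x ^+ 2 in w0.
have key k K A c : 0 < K -> w * (k ^+ 2 * A ^+ 2) <= K ->
    2 * ((k / 2 * (A * (2 / K * c))) ^+ 2 * w) <= 2 / K * c ^+ 2.
  move=> K0 le_K; have K1 : K != 0 by rewrite gt_eqF.
  rewrite (_ : 2 * _ = w * (k ^+ 2 * A ^+ 2) * (2 * c ^+ 2 / K ^+ 2));
    last by field.
  rewrite (_ : 2 / K * _ = K * (2 * c ^+ 2 / K ^+ 2)); last by field.
  by apply: ler_wpM2r => //; rewrite divr_ge0 ?sqr_ge0 // mulr_ge0 ?sqr_ge0.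
have err n : (h x - (lsum h n.+2).[x]) ^+ 2 <= (b n.+1 + b n.+2) / w.
  rewrite (lsum_error _ ch cg hg) !int11_lcoef.
  have := legendre_bound n.+1 xI'; have := legendre_bound n.+2 xI'.
  rewrite -/w => h2 h1; clearbody w; rewrite ler_pdivlMr // /b.
  have n0 : 0 <= n%:R :> R by [].
  set A := (L n.+2).[x] in h2 *; set B := (L n.+1).[x] in h1 *.
  have e1 : n.+1%:R = n%:R + 1 :> R by rewrite natr1.
  have e2 : n.+2%:R = n%:R + 2 :> R by rewrite -addn2 natrD.
  have k1 := key n.+2%:R (2 * n.+1 + 1)%:R A (lcoef g n.+1).
  have k2 := key n.+2%:R (2 * n.+2 + 1)%:R B (lcoef g n.+2).
  have {}k1 := k1 (ltr0n _ _) _; have {}k2 := k2 (ltr0n _ _) _.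
  have wA : 0 <= w * A ^+ 2 by rewrite mulr_ge0 ?sqr_ge0 // ltW.
  have wB : 0 <= w * B ^+ 2 by rewrite mulr_ge0 ?sqr_ge0 // ltW.
  apply: le_trans (lerD (k1 _) (k2 _)).
  - rewrite mulrBr; set u := _ / 2 * (A * _); set v := _ / 2 * (B * _).
    rewrite [leRHS](_ : _ = 2 * (u ^+ 2 + v ^+ 2) * w); last by ring.
    rewrite ler_pM2r //.
    by have := sqr_ge0 (u + v); rewrite !expr2; lra.
  - by rewrite natrD natrM e1 e2; rewrite e2 in h2; nra.
  - by rewrite natrD natrM e2; rewrite e1 in h1; nra.
have sq_cvg : (h x - (lsum h n.+2).[x]) ^+ 2 @[n --> \oo] --> 0.
  apply: (@squeeze_cvgr _ _ _ _ (fun=> 0) (fun n => (b n.+1 + b n.+2) / w)).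
  - by apply: nearW => n; rewrite sqr_ge0 err.
  - exact: cvg_cst.
  - rewrite -(mul0r w^-1) -(addr0 0); apply: cvgM; last exact: cvg_cst.
    apply: cvgD; first by rewrite (cvg_shiftS b).
    by rewrite (cvg_shiftS (fun n => b n.+1)) (cvg_shiftS b).
have : `|h x - (lsum h n.+2).[x]| @[n --> \oo] --> 0.
  rewrite -sqrtr0.
  rewrite (_ : (fun n => _) =
    (fun n => Num.sqrt ((h x - (lsum h n.+2).[x]) ^+ 2))).
    by apply: continuous_cvg => //; exact: sqrt_continuous.
  by apply/funext => n; rewrite sqrtr_sqr.
move/norm_cvg0P => e0.
rewrite -(cvg_shiftS (fun n => (lsum h n).[x])).
rewrite -(cvg_shiftS (fun n => (lsum h n.+1).[x])).
rewrite (_ : (fun n => _) = (fun n => h x - (h x - (lsum h n.+2).[x]))).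
  by have := cvgB (cvg_cst (h x)) e0; rewrite subr0; apply.
by apply/funext => n; rewrite subKr.
Qed.

End LegendreConvergence.

(** * Quadratic forms and splitting of integrals *)

Section QuadraticForms.
Variable R : realType.

Definition bform (m n : nat) (A : 'M[R]_(m, n)) (u : 'cV[R]_m) (v : 'cV[R]_n)
    : R := (u^T *m A *m v) 0 0.

Lemma bformE m n (A : 'M[R]_(m, n)) u v :
  bform A u v = \sum_i \sum_j u i 0 * A i j * v j 0.
Proof.
rewrite /bform mxE exchange_big /=; apply: eq_bigr => j _.
rewrite mxE mulr_suml; apply: eq_bigr => i _; by rewrite mxE.
Qed.

Lemma qformE n (A : 'M[R]_n) v :
  qform A v = \sum_i \sum_j v i 0 * A i j * v j 0.
Proof. exact: bformE. Qed.

Lemma qformD n (A B : 'M[R]_n) v : qform (A + B) v = qform A v + qform B v.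
Proof. by rewrite /qform mulmxDr mulmxDl mxE. Qed.

Lemma qformZ n c (A : 'M[R]_n) v : qform (c *: A) v = c * qform A v.
Proof. by rewrite /qform -scalemxAr -scalemxAl mxE. Qed.

Lemma qformB n (A B : 'M[R]_n) v : qform (A - B) v = qform A v - qform B v.
Proof. by rewrite -scaleN1r qformD qformZ mulN1r. Qed.

Lemma qform_sum n (I : Type) (r : seq I) (P : pred I) (A : I -> 'M[R]_n) v :
  qform (\sum_(i <- r | P i) A i) v = \sum_(i <- r | P i) qform (A i) v.
Proof. by rewrite /qform mulmx_sumr mulmx_suml summxE. Qed.

Lemma qform_congr n q (A : 'M[R]_n) (B : 'M[R]_(n, q)) v :
  qform (B^T *m A *m B) v = qform A (B *m v).
Proof. by rewrite /qform trmx_mul !mulmxA. Qed.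

Lemma bform_block m1 m2 n1 n2 (A : 'M[R]_(m1, n1)) (B : 'M[R]_(m1, n2))
    (C : 'M[R]_(m2, n1)) (D : 'M[R]_(m2, n2)) u1 u2 v1 v2 :
  bform (block_mx A B C D) (col_mx u1 u2) (col_mx v1 v2)
  = bform A u1 v1 + bform B u1 v2 + (bform C u2 v1 + bform D u2 v2).
Proof.
rewrite /bform tr_col_mx mul_row_block mul_row_col !mulmxDl !mxE.
by rewrite -!addrA; congr (_ + _); rewrite addrCA.
Qed.

Lemma bform_tr m n (A : 'M[R]_(m, n)) u v : bform A^T v u = bform A u v.
Proof.
rewrite !bformE exchange_big /=; apply: eq_bigr => i _; apply: eq_bigr => j _.
by rewrite mxE; ring.
Qed.

Lemma bform0 m n (u : 'cV[R]_m) (v : 'cV[R]_n) : bform 0 u v = 0.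
Proof. by rewrite /bform mulmx0 mul0mx mxE. Qed.

Lemma bform0l m n (A : 'M[R]_(m, n)) v : bform A 0 v = 0.
Proof. by rewrite /bform trmx0 !mul0mx mxE. Qed.

Lemma bform0r m n (A : 'M[R]_(m, n)) u : bform A u 0 = 0.
Proof. by rewrite /bform mulmx0 mxE. Qed.

Lemma bformZ m n c (A : 'M[R]_(m, n)) u v :
  bform (c *: A) u v = c * bform A u v.
Proof. by rewrite /bform -scalemxAr -scalemxAl mxE. Qed.

Lemma psd_block_diag m n (A : 'M[R]_m) (B : 'M[R]_n) :
  psd (block_mx A 0 0 B) -> psd A /\ psd B.
Proof.
case=> sym pos; move: sym; rewrite tr_block_mx !trmx0.
move=> /eq_block_mx[sA _ _ sB].
split; split=> // v.
- have := pos (col_mx v 0); rewrite [qform _ _]bform_block.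
  by rewrite !bform0 bform0l !addr0.
- have := pos (col_mx 0 v); rewrite [qform _ _]bform_block.
  by rewrite !bform0 bform0l !add0r.
Qed.

Lemma sum_ord2 (F : 'I_2 -> R) : \sum_(a < 2) F a = F 0 + F 1.
Proof.
rewrite !big_ord_recl big_ord0 addr0; congr (_ + F _).
exact: val_inj.
Qed.

End QuadraticForms.

Section Splitting.
Variable R : realType.
Implicit Types (f g h r : R -> R) (p q : {poly R}).

Local Notation L n := (legendre R n).
Local Notation cont f := ({within `[(-1 : R), 1], continuous (f : R -> R)}).

Lemma int11_split p h1 h2 n1 n2 : cont h1 -> cont h2 ->
  int11 (fun x => p.[x] * h1 x * h2 x)
  = \sum_(i < n1) \sum_(j < n2) lcoef h1 i * lcoef h2 j
      * int11 (fun x => p.[x] * (L i).[x] * (L j).[x])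
    + (\sum_(i < n1) lcoef h1 i
         * int11 (fun x => p.[x] * (L i).[x] * lrem h2 n2 x)
       + \sum_(j < n2) lcoef h2 j
         * int11 (fun x => p.[x] * (L j).[x] * lrem h1 n1 x))
    + int11 (fun x => p.[x] * lrem h1 n1 x * lrem h2 n2 x).
Proof.
move=> c1 c2; have cp : cont (horner p) by exact: cont_poly.
have cr1 : cont (lrem h1 n1) by exact: cont_lrem.
have cr2 : cont (lrem h2 n2) by exact: cont_lrem.
have cpL i : cont (fun x => p.[x] * (L i).[x]) by exact: contMpoly.
have E h n g : cont g -> int11 (fun x => g x * (lsum h n).[x])
    = \sum_(i < n) lcoef h i * int11 (fun x => g x * (L i).[x]).
  move=> cg; rewrite (_ : int11 _ = int11 (fun x =>
      \sum_(i < n) lcoef h i * (g x * (L i).[x]))); last first.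
    by apply: eq_int11 => x _; rewrite lsumE mulr_sumr;
      apply: eq_bigr => i _; ring.
  rewrite int11_sum => [|i _]; last first.
    by apply: contM; [exact: cont_cst|exact: contMpoly].
  by apply: eq_bigr => i _; rewrite int11Z //; exact: contMpoly.
have cs h n : cont (horner (lsum h n)) by exact: cont_poly.
rewrite (_ : int11 _ = int11 (fun x =>
    p.[x] * (lsum h2 n2).[x] * (lsum h1 n1).[x]
    + (p.[x] * lrem h2 n2 x * (lsum h1 n1).[x]
    + p.[x] * lrem h1 n1 x * (lsum h2 n2).[x])
    + p.[x] * lrem h1 n1 x * lrem h2 n2 x)); last first.
  by apply: eq_int11 => x _; rewrite /lrem; ring.
have k1 : cont (fun x => p.[x] * (lsum h2 n2).[x] * (lsum h1 n1).[x]).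
  by do 2!apply: contMpoly.
have k2 : cont (fun x => p.[x] * lrem h2 n2 x * (lsum h1 n1).[x]).
  by apply: contMpoly; exact: contM.
have k3 : cont (fun x => p.[x] * lrem h1 n1 x * (lsum h2 n2).[x]).
  by apply: contMpoly; exact: contM.
have k4 : cont (fun x => p.[x] * lrem h1 n1 x * lrem h2 n2 x).
  by apply: contM => //; exact: contM.
rewrite int11D //; last by apply: contD => //; exact: contD.
rewrite int11D //; last exact: contD.
rewrite (int11D k2 k3); congr (_ + (_ + _) + _).
- rewrite E; last exact: contMpoly.
  apply: eq_bigr => i _.
  rewrite (_ : int11 _ = int11 (fun x => p.[x] * (L i).[x] * (lsum h2 n2).[x])).
    by rewrite E // mulr_sumr; apply: eq_bigr => j _; rewrite mulrA.
  by apply: eq_int11 => x _; ring.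
- rewrite E; last exact: contM.
  by apply: eq_bigr => i _; congr (_ * _); apply: eq_int11 => x _; ring.
- rewrite E; last exact: contM.
  by apply: eq_bigr => i _; congr (_ * _); apply: eq_int11 => x _; ring.
Qed.

(** The matrix [Phi] of the problem, for an arbitrary polynomial factor. *)
Definition coupling d M p : 'M[R]_d := \matrix_(i, j)
  int11 (fun x => p.[x] * (L (M - d + i.+1)).[x] * (L (M + j.+1)).[x]).

Definition modes d n h : 'cV[R]_d := \col_i lcoef h (n + i.+1).

(** A factor [q] of degree at most [d] couples Legendre modes at distance at
    most [d]. So [q L_i] is orthogonal to the remainder unless [M - d < i],
    and for the remaining [i] only the modes up to [M + d] of the remainder
    are seen. *)
Lemma cross_terms q h1 h2 d M : cont h1 -> cont h2 -> (size q <= d.+1)%N ->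
  (d <= M)%N ->
  \sum_(i < M.+1) lcoef h1 i
     * int11 (fun x => q.[x] * (L i).[x] * lrem h2 M.+1 x)
  = bform (coupling d M q) (modes d (M - d) h1) (modes d M h2).
Proof.
move=> c1 c2 sq dM; rewrite bformE.
have Z i n : (size q + i <= n.+1)%N ->
    int11 (fun x => q.[x] * (L i).[x] * lrem h2 n.+1 x) = 0.
  move=> sn; rewrite -(@int11_poly_legendre_orth _ n (lrem h2 n.+1) q i).
  - by apply: eq_int11 => x _; rewrite mulrC.
  - exact: cont_lrem.
  - by move=> j jn; rewrite int11_lrem_legendre // ltnS jn.
  - by [].
have split_sum (F : nat -> R) : \sum_(i < M.+1) F i
    = \sum_(i < (M - d).+1) F i + \sum_(i < d) F (M - d + i.+1)%N.
  have -> : M.+1 = ((M - d).+1 + d)%N by lia.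
  rewrite big_split_ord /=; congr (_ + _).
  by apply: eq_bigr => i _; rewrite addSnnS.
rewrite (split_sum (fun i => lcoef h1 i
  * int11 (fun x => q.[x] * (L i).[x] * lrem h2 M.+1 x))).
rewrite big1 ?add0r; last first.
  move=> i _; rewrite Z ?mulr0 //.
  by have := ltn_ord i; move: (nat_of_ord i) => {}i; lia.
apply: eq_bigr => i _.
set I := (M - d + i.+1)%N.
have cqL : cont (fun x => q.[x] * (L I).[x]).
  by apply: contMpoly; exact: cont_poly.
rewrite (_ : int11 _ = int11 (fun x =>
    q.[x] * (L I).[x] * lrem h2 (M.+1 + d) x
    + \sum_(j < d) lcoef h2 (M + j.+1) *
        (q.[x] * (L I).[x] * (L (M + j.+1)).[x]))); last first.
  apply: eq_int11 => x _; rewrite /lrem !lsumE big_split_ord /=.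
  rewrite [X in _ = _ + X](eq_bigr (fun j : 'I_d => q.[x] * (L I).[x] *
    (lcoef h2 (M + j.+1) * (L (M + j.+1)).[x]))); last by move=> j _; ring.
  rewrite -mulr_sumr.
  rewrite [X in _ * (_ - (_ + X)) + _](eq_bigr (fun j : 'I_d =>
    (lcoef h2 (M + j.+1) * (L (M + j.+1)).[x]))); first by ring.
  by move=> j _; rewrite addSnnS.
rewrite int11D; last 2 first.
- by apply: contM => //; exact: cont_lrem.
- by apply: cont_sum => j _; apply: contM; [exact: cont_cst|exact: contMpoly].
have iM : (I <= M)%N by rewrite /I; have := ltn_ord i; lia.
rewrite (_ : int11 _ = 0) ?add0r; last first.
  by apply: (@Z I (M + d)%N); clearbody I; lia.
rewrite int11_sum => [|j _]; last first.
  by apply: contM; [exact: cont_cst|exact: contMpoly].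
rewrite mulr_sumr; apply: eq_bigr => j _; rewrite int11Z; last exact: contMpoly.
by rewrite !mxE; ring.
Qed.

End Splitting.

(** * The LMI bound and the expansion of the functional *)

Section Omega.
Variable R : realType.
Local Notation cont f := ({within `[(-1 : R), 1], continuous (f : R -> R)}).

Lemma bform_delta m n (A : 'M[R]_(m, n)) i j :
  bform A (delta_mx i 0) (delta_mx j 0) = A i j.
Proof. by rewrite /bform trmx_delta -rowE -colE !mxE. Qed.

Lemma bform_DeltaM d M (u v : 'cV[R]_d) :
  bform (DeltaM R d M) u v
  = \sum_(i < d) 2 / (2 * (M + i.+1) + 1)%:R * (u i 0 * v i 0).
Proof.
rewrite bformE; apply: eq_bigr => i _.
rewrite (bigD1 i) //= big1 => [|j /negbTE ji]; rewrite !mxE ?eqxx.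
  by rewrite mulr1n; ring.
by rewrite eq_sym ji mulr0n mulr0 mul0r.
Qed.

Lemma is_diag_mx2 (S : 'M[R]_2) : is_diag_mx S -> S 0 1 = 0 /\ S 1 0 = 0.
Proof. by move/is_diag_mxP => h; split; apply: h. Qed.

Lemma int11_qform_diag (S : 'M[R]_2) (r : 'I_2 -> R -> R) :
  is_diag_mx S -> (forall a, cont (r a)) ->
  int11 (fun x => qform S (\col_a r a x))
  = S 0 0 * int11 (fun x => r 0 x * r 0 x)
    + S 1 1 * int11 (fun x => r 1 x * r 1 x).
Proof.
move=> /is_diag_mx2[S01 S10] cr.
have crr a : cont (fun x => r a x * r a x) by exact: contM.
rewrite -!int11Z // -int11D; last 2 first.
- by apply: contM => //; exact: cont_cst.
- by apply: contM => //; exact: cont_cst.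
apply: eq_int11 => x _.
by rewrite qformE !sum_ord2 !mxE S01 S10; ring.
Qed.

(** Evaluate the positive form [Omega] at [u] and the first [d] discarded
    modes. The block [DeltaM] holds the squared norms of the discarded
    Legendre polynomials, so by Bessel's inequality the contribution of [S]
    is at most its integral against the remainders. This step needs the
    diagonal entries of [S] to be nonnegative: they are, as a diagonal block
    of a positive matrix, unless [d = 0]. *)
Lemma Omega_bound d M (Q Yab : 'M[R]_(d + d)) (S : 'M[R]_2)
    (h : 'I_2 -> R -> R) (u : 'cV[R]_(d + d)) :
  (forall a, cont (h a)) -> psd (Omega M Q Yab S) -> is_diag_mx S ->
  (d = 0%N -> S = 0) ->
  - qform Q u - int11 (fun x => qform S (\col_a lrem (h a) M.+1 x))
  <= 2 * bform Yab u (col_mx (\col_(j < d) lcoef (h 0) (M + j.+1))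
                             (\col_(j < d) lcoef (h 1) (M + j.+1))).
Proof.
move=> ch [_ pos] dS S0; have [S01 S10] := is_diag_mx2 dS.
have kronE (v0 v1 : 'cV[R]_d) : bform (kron2 S (DeltaM R d M)) (col_mx v0 v1)
    (col_mx v0 v1) = S 0 0 * bform (DeltaM R d M) v0 v0
                     + S 1 1 * bform (DeltaM R d M) v1 v1.
  by rewrite bform_block !bformZ S01 S10; ring.
have Sge0 : 0 <= S 0 0 /\ 0 <= S 1 1.
  have [d0|d0] := posnP d; first by rewrite S0 // !mxE.
  pose e : 'cV[R]_d := delta_mx (Ordinal d0) 0.
  have De : 0 < bform (DeltaM R d M) e e.
    by rewrite bform_delta !mxE eqxx mulr1n divr_gt0 ?ltr0n // addn1.
  have pos2 v : 0 <= bform (kron2 S (DeltaM R d M)) v v.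
    have := pos (col_mx 0 v); rewrite [qform _ _]bform_block.
    by rewrite !bform0l bform0r !add0r.
  split; rewrite -(pmulr_lge0 _ De).
  - have := pos2 (col_mx e 0); rewrite kronE bform0l mulr0 addr0.
    by [].
  - by have := pos2 (col_mx 0 e); rewrite kronE bform0l mulr0 add0r.
case: Sge0 => Sge0 Sge1.
set y := col_mx _ _.
have := pos (col_mx u y); rewrite [qform _ _]bform_block bform_tr.
rewrite {3 4}/y kronE int11_qform_diag // => [|a]; last first.
  exact: cont_lrem.
have tail a : bform (DeltaM R d M) (\col_(j < d) lcoef (h a) (M + j.+1))
    (\col_(j < d) lcoef (h a) (M + j.+1))
    <= int11 (fun x => lrem (h a) M.+1 x * lrem (h a) M.+1 x).
  apply: le_trans (bessel_tail M.+1 d (ch a)).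
  rewrite bform_DeltaM le_eqVlt; apply/orP; left; apply/eqP.
  by apply: eq_bigr => j _; rewrite !mxE addSnnS expr2.
have t0 := ler_wpM2l Sge0 (tail 0); have t1 := ler_wpM2l Sge1 (tail 1).
have -> : bform Q u u = qform Q u by [].
by lra.
Qed.

End Omega.

Section Expansion.
Variable R : realType.
Local Notation L n := (legendre R n).
Local Notation cont f := ({within `[(-1 : R), 1], continuous (f : R -> R)}).

Lemma cont_dern m (w : 'I_2 -> R -> R) a i : Cm2 m w -> (i <= m)%N ->
  cont (dern i (w a)).
Proof. by move=> /(_ a)[_]; apply. Qed.

(** The tail is defined as a pointwise limit; pointwise convergence of the
    Legendre series identifies it with a continuous function. *)
Lemma wtail_lrem m (w : 'I_2 -> R -> R) a i n x : Cm2 m w -> (i < m)%N ->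
  x \in `]-1, 1[ -> wtail w a i n x = lrem (dern i (w a)) n.+1 x.
Proof.
move=> Cw im xI; set h := dern i (w a).
have ch : cont h by apply: cont_dern Cw _; exact: ltnW.
have hd : cvg ((fun y => (h y - h x) / (y - x)) @ within `[-1, 1] x^').
  by case: (Cw a) => + _; apply => //; exact: subset_itv_oo_cc xI.
apply/cvg_lim => //.
have e : \forall j \near \oo, (lsum h j).[x] - (lsum h n.+1).[x]
    = \sum_(n.+1 <= l < j) wcoef w a i l * (L l).[x].
  near=> j; have nj : (n.+1 <= j)%N by near: j; exact: nbhs_infty_ge.
  rewrite !lsumE -!(big_mkord xpredT (fun l => lcoef h l * (L l).[x])).
  by rewrite (big_cat_nat (leq0n _) nj) /= addrAC subrr add0r.
apply: cvg_trans (near_eq_cvg e) _.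
apply: cvgB; last exact: cvg_cst.
exact: legendre_cvg.
Unshelve. all: by end_near. Qed.

Lemma int11_PQR m k N M (p : {poly R}) (w : 'I_2 -> R -> R) a b
    (alpha beta : 'I_k.+1) : Cm2 m w -> (k < m)%N ->
  int11 (fun x => p.[x] * dern alpha (w a) x * dern beta (w b) x)
  = Pcal N M p w a b alpha beta + Qcal N M p w a b alpha beta
    + Rcal N M p w a b alpha beta.
Proof.
move=> Cw km.
have ltm (i : 'I_k.+1) : (i < m)%N by have := ltn_ord i; lia.
have ch (i : 'I_k.+1) c : cont (dern i (w c)).
  by apply: cont_dern Cw _; exact: ltnW.
have cr (i : 'I_k.+1) c n : cont (lrem (dern i (w c)) n).
  by apply: cont_lrem.
have cp : cont (horner p) by exact: cont_poly.
rewrite (@int11_split _ p _ _ (trunc N M alpha beta).+1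
                              (trunc N M beta alpha).+1) //.
rewrite /Pcal /Qcal /Rcal; congr (_ + (_ + _) + _).
- apply: eq_bigr => i _; congr (_ * _); apply/esym/int11_oo.
    by apply: contM => //; exact: contMpoly.
  by move=> x xI; rewrite (wtail_lrem _ _ Cw).
- apply: eq_bigr => i _; congr (_ * _); apply/esym/int11_oo.
    by apply: contM => //; exact: contMpoly.
  by move=> x xI; rewrite (wtail_lrem _ _ Cw).
- apply/esym/int11_oo; first by apply: contM => //; exact: contM.
  by move=> x xI; rewrite !(wtail_lrem _ _ Cw).
Qed.

Lemma sum_pos k (F : 'I_(k.+1 + k.+1) -> R) :
  \sum_i F i = \sum_(a < 2) \sum_(alpha < k.+1) F (pos a alpha).
Proof. by rewrite sum_ord2 big_split_ord. Qed.

Lemma Dvec_pos k (w : 'I_2 -> R -> R) x a (alpha : 'I_k.+1) :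
  (Dvec 0 k w x : 'cV[R]_(k.+1 + k.+1)) (pos a alpha) 0 = dern alpha (w a) x.
Proof.
rewrite /Dvec /pos; case: ifP => [/eqP ->|a0].
  by rewrite (@col_mxEu R k.+1 k.+1 1) mxE.
have -> : a = 1 by apply: val_inj; case: a a0 => [[|[|?]]].
by rewrite (@col_mxEd R k.+1 k.+1 1) mxE.
Qed.

Lemma Fcal_sum m k (F : 'M[{poly R}]_(k.+1 + k.+1)) w : Cm2 m w -> (k < m)%N ->
  Fcal F w = \sum_(a < 2) \sum_(b < 2) \sum_(alpha < k.+1) \sum_(beta < k.+1)
    int11 (fun x => (fent F a b alpha beta).[x] * dern alpha (w a) x
                    * dern beta (w b) x).
Proof.
move=> Cw km.
have ch (i : 'I_k.+1) c : cont (dern i (w c)).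
  by apply: cont_dern Cw _; have := ltn_ord i; lia.
have c1 a b alpha beta : cont (fun x => (fent F a b alpha beta).[x]
    * dern (alpha : 'I_k.+1) (w a) x * dern (beta : 'I_k.+1) (w b) x).
  by do 2?apply: contM => //; exact: cont_poly.
transitivity (int11 (fun x => \sum_(a < 2) \sum_(b < 2) \sum_(alpha < k.+1)
    \sum_(beta < k.+1) (fent F a b alpha beta).[x] * dern alpha (w a) x
                    * dern beta (w b) x)).
  apply: eq_int11 => x _; rewrite qformE sum_pos; apply: eq_bigr => a _.
  rewrite [RHS]exchange_big /=; apply: eq_bigr => alpha _.
  rewrite sum_pos; apply: eq_bigr => b _; apply: eq_bigr => beta _.
  by rewrite !Dvec_pos mxE -/(fent F a b alpha beta); ring.
rewrite int11_sum => [|a _]; last by do 3!apply: cont_sum => ? _.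
apply: eq_bigr => a _.
rewrite int11_sum => [|b _]; last by do 2!apply: cont_sum => ? _.
apply: eq_bigr => b _.
rewrite int11_sum => [|alpha _]; last by apply: cont_sum => ? _.
by apply: eq_bigr => alpha _; rewrite int11_sum.
Qed.

End Expansion.

(** * Assembling the lower bound *)

Section Remainder.
Variables (R : realType) (r : 'I_2 -> R -> R).
Local Notation cont f := ({within `[(-1 : R), 1], continuous (f : R -> R)}).
Hypothesis cr : forall a, cont (r a).

(** The integral of the quadratic form of a constant matrix along the
    remainders; it is linear in the matrix. *)
Definition int11_form (A : 'M[R]_2) : R :=
  int11 (fun x => qform A (\col_a r a x)).

Lemma cont_qform (S : R -> 'M[R]_2) :
  (forall a b, cont (fun x => S x a b)) ->
  cont (fun x => qform (S x) (\col_a r a x)).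
Proof.
move=> cS; rewrite (_ : (fun _ => _) = fun x =>
    \sum_(a < 2) \sum_(b < 2) S x a b * r a x * r b x).
  by do 2!apply: cont_sum => ? _; do 2?apply: contM.
apply/funext => x; rewrite qformE; apply: eq_bigr => a _.
by apply: eq_bigr => b _; rewrite !mxE; ring.
Qed.

Lemma int11_qform (S : R -> 'M[R]_2) :
  (forall a b, cont (fun x => S x a b)) ->
  int11 (fun x => qform (S x) (\col_a r a x))
  = \sum_(a < 2) \sum_(b < 2) int11 (fun x => S x a b * r a x * r b x).
Proof.
move=> cS; have c a b : cont (fun x => S x a b * r a x * r b x).
  by do 2?apply: contM.
transitivity (int11 (fun x =>
    \sum_(a < 2) \sum_(b < 2) S x a b * r a x * r b x)).
  apply: eq_int11 => x _; rewrite qformE; apply: eq_bigr => a _.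
  by apply: eq_bigr => b _; rewrite !mxE; ring.
rewrite int11_sum => [|a _]; last by apply: cont_sum => ? _.
by apply: eq_bigr => a _; rewrite int11_sum.
Qed.

Lemma int11_formE A : int11_form A
  = \sum_(a < 2) \sum_(b < 2) A a b * int11 (fun x => r a x * r b x).
Proof.
rewrite /int11_form int11_qform => [|a b]; last exact: cont_cst.
apply: eq_bigr => a _; apply: eq_bigr => b _.
rewrite -int11Z; last exact: contM.
by apply: eq_int11 => x _; rewrite mulrA.
Qed.

Lemma int11_formD A B : int11_form (A + B) = int11_form A + int11_form B.
Proof. by rewrite !int11_formE !sum_ord2 !mxE; ring. Qed.

Lemma int11_formZ c A : int11_form (c *: A) = c * int11_form A.
Proof. by rewrite !int11_formE !sum_ord2 !mxE; ring. Qed.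

Lemma int11_form_sum (I : Type) (s : seq I) (P : pred I) (A : I -> 'M[R]_2) :
  int11_form (\sum_(i <- s | P i) A i) = \sum_(i <- s | P i) int11_form (A i).
Proof.
elim/big_rec2 : _ => [|i y B _ <-]; last by rewrite int11_formD.
by rewrite int11_formE !sum_ord2 !mxE; ring.
Qed.

End Remainder.

Lemma sum_split_ord_max (R : realType) k (F : 'I_k.+1 -> 'I_k.+1 -> R) :
  \sum_alpha \sum_beta F alpha beta
  = F ord_max ord_max + \sum_alpha \sum_(beta | (alpha, beta)
      != (ord_max, ord_max)) F alpha beta.
Proof.
transitivity (\sum_alpha (\sum_(beta | (alpha, beta) == (ord_max, ord_max))
    F alpha beta + \sum_(beta | (alpha, beta) != (ord_max, ord_max))
    F alpha beta)).
  apply: eq_bigr => alpha _.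
  by rewrite (bigID (fun beta => (alpha, beta) == (ord_max, ord_max))).
rewrite big_split /=; congr (_ + _).
rewrite (bigD1 ord_max) //= [X in _ + X]big1 ?addr0.
  by rewrite (big_pred1 ord_max) // => j; rewrite xpair_eqE eqxx.
move=> i im; apply: big1 => j; rewrite xpair_eqE => /andP[/eqP ie _].
by rewrite ie eqxx in im.
Qed.

(* From here on, integrals matter only through linearity and positivity. *)
#[local] Opaque int11.

Section TopOrder.
Variable R : realType.
Local Notation L n := (legendre R n).
Local Notation cont f := ({within `[(-1 : R), 1], continuous (f : R -> R)}).

(** The truncated part [Pcal] for the top order, for arbitrary functions. *)
Definition low_part M (p : {poly R}) h1 h2 : R :=
  \sum_(i < M.+1) \sum_(j < M.+1) lcoef h1 i * lcoef h2 j
     * int11 (fun x => p.[x] * (L i).[x] * (L j).[x]).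

Lemma int11_split_coupling d M (p : {poly R}) h1 h2 : cont h1 -> cont h2 ->
  (size p <= d.+1)%N -> (d <= M)%N ->
  int11 (fun x => p.[x] * h1 x * h2 x) = low_part M p h1 h2
    + (bform (coupling d M p) (modes d (M - d) h1) (modes d M h2)
       + bform (coupling d M p) (modes d (M - d) h2) (modes d M h1))
    + int11 (fun x => p.[x] * lrem h1 M.+1 x * lrem h2 M.+1 x).
Proof.
move=> c1 c2 sp dM; rewrite (int11_split p M.+1 M.+1 c1 c2).
by congr (_ + (_ + _) + _); exact: cross_terms.
Qed.

(** Only the top-order cross terms are not quadratic in the retained modes:
    they involve discarded modes of [h] itself. Each is bounded by its own
    matrix [Omega]; the two mixed terms agree because [p] is symmetric,
    which accounts for the factors [2]. *)
Lemma top_order_bound d M (p : 'I_2 -> 'I_2 -> {poly R}) (h : 'I_2 -> R -> R)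
    (Q11 Q12 Q22 : 'M[R]_(d + d)) (S11 S12 S22 : 'M[R]_2) :
  let r a := lrem (h a) M.+1 in
  p 1 0 = p 0 1 -> (forall a b, (size (p a b) <= d.+1)%N) ->
  (forall a, cont (h a)) -> (d <= M)%N ->
  psd (Omega M Q11 (block_mx (coupling d M (p 0 0)) 0 0 0) S11) ->
  psd (Omega M Q12 (2^-1 *: block_mx 0 (coupling d M (p 0 1))
                                      (coupling d M (p 0 1)) 0) S12) ->
  psd (Omega M Q22 (block_mx 0 0 0 (coupling d M (p 1 1))) S22) ->
  is_diag_mx S11 -> is_diag_mx S12 -> is_diag_mx S22 ->
  (d = 0%N -> S11 = 0) -> (d = 0%N -> S12 = 0) -> (d = 0%N -> S22 = 0) ->
  low_part M (p 0 0) (h 0) (h 0) + 2 * low_part M (p 0 1) (h 0) (h 1)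
  + low_part M (p 1 1) (h 1) (h 1)
  - qform (Q11 + 2 *: Q12 + Q22)
      (col_mx (modes d (M - d) (h 0)) (modes d (M - d) (h 1)))
  - int11_form r (S11 + 2 *: S12 + S22)
  + \sum_(a < 2) \sum_(b < 2) int11 (fun x => (p a b).[x] * r a x * r b x)
  <= \sum_(a < 2) \sum_(b < 2) int11 (fun x => (p a b).[x] * h a x * h b x).
Proof.
move=> r p_sym sp ch dM psd11 psd12 psd22 d11 d12 d22 z11 z12 z22.
have cr a : cont (r a) by exact: cont_lrem.
set u := col_mx _ _.
have b11 := Omega_bound u ch psd11 d11 z11.
have b12 := Omega_bound u ch psd12 d12 z12.
have b22 := Omega_bound u ch psd22 d22 z22.
rewrite bform_block !bform0 -/(int11_form r S11) in b11.
rewrite bformZ bform_block !bform0 -/(int11_form r S12) in b12.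
rewrite bform_block !bform0 -/(int11_form r S22) in b22.
have swap (h' : 'I_2 -> R -> R) : int11 (fun x => (p 1 0).[x] * h' 1 x * h' 0 x)
             = int11 (fun x => (p 0 1).[x] * h' 0 x * h' 1 x).
  by apply: eq_int11 => x _; rewrite p_sym mulrAC.
have sum22 (F : 'I_2 -> 'I_2 -> R) :
    \sum_a \sum_b F a b = F 0 0 + F 0 1 + (F 1 0 + F 1 1).
  by rewrite !sum_ord2.
rewrite [X in _ + X <= _]sum22 [leRHS]sum22.
rewrite (swap h) (swap r) 2!qformD qformZ 2!(int11_formD cr) (int11_formZ cr).
rewrite (int11_split_coupling (ch 0) (ch 0) (sp 0 0) dM).
rewrite (int11_split_coupling (ch 0) (ch 1) (sp 0 1) dM).
rewrite (int11_split_coupling (ch 1) (ch 1) (sp 1 1) dM).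
rewrite -/(r 0) -/(r 1).
move: b11 b12 b22.
move: (int11 (fun x => (p 0 0).[x] * _ * _)) => I00.
move: (int11 (fun x => (p 0 1).[x] * _ * _)) => I01.
move: (int11 (fun x => (p 1 1).[x] * _ * _)) => I11.
move: (low_part _ _ (h 0) (h 0)) => l00.
move: (low_part _ _ (h 0) (h 1)) => l01.
move: (low_part _ _ (h 1) (h 1)) => l11.
move: (bform _ (modes _ _ (h 0)) (modes _ _ (h 0))) => B00.
move: (bform _ (modes _ _ (h 0)) (modes _ _ (h 1))) => B01.
move: (bform _ (modes _ _ (h 1)) (modes _ _ (h 0))) => B10.
move: (bform _ (modes _ _ (h 1)) (modes _ _ (h 1))) => B11.
move: (qform Q11 _) (qform Q12 _) (qform Q22 _) => q11 q12 q22.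
move: (int11_form r S11) (int11_form r S12) (int11_form r S22) => r11 r12 r22.
clear; lra.
Qed.

End TopOrder.

Section Fgamma.
Variables (R : realType) (k s d : nat) (F0 : 'M[{poly R}]_(k.+1 + k.+1))
  (Fi : 'I_s -> 'M[{poly R}]_(k.+1 + k.+1)).
Hypotheses (F0_sym : F0^T = F0) (Fi_sym : forall i, (Fi i)^T = Fi i).
Hypothesis F0_deg : forall r c, (size (F0 r c) <= d.+1)%N.
Hypothesis Fi_deg : forall i r c, (size (Fi i r c) <= d.+1)%N.

Lemma fent_sym g a b alpha beta :
  fent (Fgam F0 Fi g) a b alpha beta = fent (Fgam F0 Fi g) b a beta alpha.
Proof.
rewrite /fent !mxE !summxE -[in LHS]F0_sym mxE; congr (_ + _).
by apply: eq_bigr => i _; rewrite !mxE -[in LHS]Fi_sym mxE.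
Qed.

Lemma size_fent g a b alpha beta :
  (size (fent (Fgam F0 Fi g) a b alpha beta) <= d.+1)%N.
Proof.
rewrite /fent !mxE summxE; apply: leq_trans (size_polyD _ _) _.
rewrite geq_max F0_deg /=; apply: leq_trans (size_sum _ _ _) _.
apply/bigmax_leqP => i _; rewrite mxE mul_polyC.
exact: leq_trans (size_scale_leq _ _) (Fi_deg _ _ _).
Qed.

End Fgamma.

Theorem proposition1 (R : realType) (m k l p s dF N M : nat)
  (hkm : (1 <= k <= m - 1)%N) (hkl : (k <= l <= m)%N)
  (hN : (dF + k - 1 <= N)%N) (hM : M = (N + 2 * k + dF)%N)
  (F0 : 'M[{poly R}]_(k.+1 + k.+1))
  (Fi : 'I_s -> 'M[{poly R}]_(k.+1 + k.+1))
  (F0_sym : F0^T = F0) (Fi_sym : forall i : 'I_s, (Fi i)^T = Fi i)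
  (F0_deg : forall r c : 'I_(k.+1 + k.+1), (size (F0 r c) <= dF.+1)%N)
  (Fi_deg : forall (i : 'I_s) (r c : 'I_(k.+1 + k.+1)),
     (size (Fi i r c) <= dF.+1)%N)
  (A : 'M[R]_(p, bdim 0 l))
  (P Q : 'I_2 -> 'I_2 -> 'I_k.+1 -> 'I_k.+1 -> 'rV[R]_s -> 'M[R]_(pdim k M))
  (Rm : 'I_2 -> 'I_2 -> 'I_k.+1 -> 'I_k.+1 -> 'M[R]_(pdim k M))
  (Sig : 'I_2 -> 'I_2 -> 'I_k.+1 -> 'I_k.+1 -> 'M[R]_2)
  (P_sym : forall a b alpha beta g, (P a b alpha beta g)^T = P a b alpha beta g)
  (P_aff : forall a b alpha beta, affine_mx (P a b alpha beta))
  (P_eq : forall a b alpha beta g w, Cm2 m w ->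
     Pcal N M (fent (Fgam F0 Fi g) a b alpha beta) w a b alpha beta
     = qform (P a b alpha beta g) (psi k M w))
  (Q_sym : forall a b alpha beta g, (alpha, beta) != (ord_max, ord_max) ->
     (Q a b alpha beta g)^T = Q a b alpha beta g)
  (Q_aff : forall a b alpha beta, (alpha, beta) != (ord_max, ord_max) ->
     affine_mx (Q a b alpha beta))
  (Q_eq : forall a b alpha beta g w, (alpha, beta) != (ord_max, ord_max) ->
     Cm2 m w ->
     Qcal N M (fent (Fgam F0 Fi g) a b alpha beta) w a b alpha beta
     = qform (Q a b alpha beta g) (psi k M w))
  (R_psd : forall a b alpha beta, (alpha, beta) != (ord_max, ord_max) ->
     psd (Rm a b alpha beta))
  (Sig_pd : forall a b alpha beta, (alpha, beta) != (ord_max, ord_max) ->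
     pd (Sig a b alpha beta))
  (R_bound : forall a b alpha beta g w, (alpha, beta) != (ord_max, ord_max) ->
     Cm2 m w ->
     `|Rcal N M (fent (Fgam F0 Fi g) a b alpha beta) w a b alpha beta|
     <= lnorm1 (fent (Fgam F0 Fi g) a b alpha beta)
        * (qform (Rm a b alpha beta) (psi k M w)
           + int11 (fun x => qform (Sig a b alpha beta) (UV k M w x))))
  (L : 'M[R]_(dF + dF, pdim k M))
  (L_eq : forall w, Cm2 m w -> L *m psi k M w = Lvec k dF M w)
  (Pm : 'M[R]_(bdim 0 l, bdim 0 k.-1 + bdim k l))
  (Pm_perm : rect_perm_mx Pm)
  (Pm_eq : forall w, Cm2 m w ->
     Bvec 0 l w = Pm *m col_mx (Bvec 0 k.-1 w) (Bvec k l w))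
  (J : 'M[R]_(bdim 0 k.-1, pdim k M))
  (J_eq : forall w, Cm2 m w -> Bvec 0 k.-1 w = J *m psi k M w)
  (Lam : 'M[R]_(pdim k M + bdim k l, \rank (kermx (Kmx A Pm J)^T)))
  (Lam_range : forall v : 'cV[R]_(pdim k M + bdim k l),
     Kmx A Pm J *m v = 0 <-> exists z, v = Lam *m z) :
  Tin (Fgam F0 Fi) P Q Rm Sig L Lam `<=` Tset m F0 Fi A.
Proof.
move=> g [Y [[_ [[dY11 dY12 dY22] Y0]] psdO psdQ psdS]] w [Cw Aw].
have km : (k < m)%N by move: hkm; lia.
have dM : (dF <= M)%N by lia.
set F := Fgam F0 Fi; set f := fent (F g).
pose h a := dern k (w a); pose r a := lrem (h a) M.+1.
have ch a : {within `[(-1 : R), 1], continuous (h a)}.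
  by apply: cont_dern Cw _; exact: ltnW.
have cr a : {within `[(-1 : R), 1], continuous (r a)} by exact: cont_lrem.
set v := psi k M w.
have UVr x : x \in `]-1, 1[ -> UV k M w x = \col_a r a x.
  by move=> xI; apply/colP => a; rewrite !mxE (wtail_lrem _ _ Cw).
(* By the boundary conditions, the vector of coefficients and boundary
   values lies in the null space of [Kmx], hence in the range of [Lam]. *)
have QM_ge0 : 0 <= qform (QM F P Q Rm L g Y) v.
  pose V := col_mx v (Bvec k l w).
  have : Kmx A Pm J *m V = 0.
    rewrite /Kmx -mulmxA mul_block_col !mul0mx mul1mx addr0 add0r.
    by rewrite -J_eq // -mulmxA -Pm_eq.
  move=> /Lam_range[z Vz]; have -> : v = usubmx Lam *m z.
    by rewrite mul_usub_mx -Vz col_mxKu.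
  by rewrite -qform_congr; case: psdQ => _; apply.
have cS a b : {within `[(-1 : R), 1], continuous (fun x => Smx (F g) x a b)}.
  rewrite (_ : (fun x => _) = horner (f a b ord_max ord_max)).
    exact: cont_poly.
  by apply/funext => x; rewrite mxE.
have S_ge0 : 0 <= int11 (fun x => qform (Smx (F g) x) (\col_a r a x))
                  - int11_form r (SigmaM F Sig g Y).
  rewrite -int11B; [|exact: cont_qform|]; last first.
    by apply: cont_qform => // a b; exact: cont_cst.
  apply: int11_ge0 => x xI; rewrite -qformB.
  by case: (psdS x xI) => _; apply.
have kk_part : \sum_(a < 2) \sum_(b < 2)
    int11 (fun x => (f a b ord_max ord_max).[x] * h a x * h b x)
  >= qform (P 0 0 ord_max ord_max g) v + 2 * qform (P 0 1 ord_max ord_max g) v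
     + qform (P 1 1 ord_max ord_max g) v
     - qform (Qk11 Y + 2 *: Qk12 Y + Qk22 Y) (L *m v)
     - int11_form r (Sk11 Y + 2 *: Sk12 Y + Sk22 Y)
     + int11 (fun x => qform (Smx (F g) x) (\col_a r a x)).
  have fk_sym : f 1 0 ord_max ord_max = f 0 1 ord_max ord_max.
    exact: fent_sym.
  have PhiE a b : Phi dF M (F g) a b = coupling dF M (f a b ord_max ord_max).
    apply/matrixP => i j; rewrite [LHS]mxE [RHS]mxE.
    by apply: eq_int11 => x _; rewrite mxE.
  have [psd11 /psd_block_diag[psd12 psd22]] := psd_block_diag psdO.
  rewrite !PhiE in psd11 psd12 psd22.
  have [S0 S1 S2] : [/\ dF = 0%N -> Sk11 Y = 0, dF = 0%N -> Sk12 Y = 0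
               & dF = 0%N -> Sk22 Y = 0].
    by split=> /Y0[].
  have Lu : L *m v = col_mx (modes dF (M - dF) (h 0)) (modes dF (M - dF) (h 1)).
    rewrite (L_eq w Cw) /Lvec; congr col_mx; apply/colP => i;
      by rewrite !mxE /wcoef; congr lcoef; lia.
  have PE a b : qform (P a b ord_max ord_max g) v
      = low_part M (f a b ord_max ord_max) (h a) (h b).
    by rewrite -P_eq // /Pcal /trunc eqxx.
  have := @top_order_bound R dF M (fun a b => f a b ord_max ord_max) h
    (Qk11 Y) (Qk12 Y) (Qk22 Y) (Sk11 Y) (Sk12 Y) (Sk22 Y) fk_sym
    (fun a b => size_fent F0_deg Fi_deg g a b ord_max ord_max) ch dM
    psd11 psd12 psd22 dY11 dY12 dY22 S0 S1 S2.
  rewrite -!PE -Lu int11_qform //.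
  have SE a b : int11 (fun x => Smx (F g) x a b * r a x * r b x)
      = int11 (fun x => (f a b ord_max ord_max).[x] * r a x * r b x).
    by apply: eq_int11 => x _; rewrite mxE.
  by under [X in _ -> is_true (_ + X <= _)]eq_bigr do
    under eq_bigr do rewrite SE.
(* For the remaining pairs of orders, the remainder is controlled by its a
   priori bound. *)
have other a b alpha beta : (alpha, beta) != (ord_max, ord_max) ->
    int11 (fun x => (f a b alpha beta).[x] * dern alpha (w a) x
                    * dern beta (w b) x)
    >= qform (P a b alpha beta g + Q a b alpha beta g
              - lnorm1 (f a b alpha beta) *: Rm a b alpha beta) v
       - int11_form r (lnorm1 (f a b alpha beta) *: Sig a b alpha beta).
  move=> ne; rewrite (int11_PQR N M _ _ _ _ _ Cw) //.
  rewrite P_eq // Q_eq // qformB qformD qformZ int11_formZ //.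
  have := R_bound a b alpha beta g w ne Cw.
  rewrite (_ : int11 (fun x => qform _ (UV k M w x))
             = int11_form r (Sig a b alpha beta)).
    by rewrite ler_norml => /andP[+ _]; rewrite -/v -/F -/f mulrDr; lra.
  apply: int11_oo => [|x xI]; last by rewrite UVr.
  by apply: cont_qform => // ? ?; exact: cont_cst.
rewrite /Tset /= (Fcal_sum _ Cw) // -/f.
have -> : \sum_(a < 2) \sum_(b < 2) \sum_alpha \sum_beta
    int11 (fun x => (f a b alpha beta).[x] * dern alpha (w a) x
                    * dern beta (w b) x)
  = \sum_(a < 2) \sum_(b < 2)
      int11 (fun x => (f a b ord_max ord_max).[x] * h a x * h b x)
    + \sum_(a < 2) \sum_(b < 2) \sum_alpha
      \sum_(beta | (alpha, beta) != (ord_max, ord_max))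
      int11 (fun x => (f a b alpha beta).[x] * dern alpha (w a) x
                      * dern beta (w b) x).
  rewrite -big_split; apply: eq_bigr => a _; rewrite -big_split.
  by apply: eq_bigr => b _; rewrite sum_split_ord_max.
have others : qform (\sum_(a < 2) \sum_(b < 2) \sum_alpha
      \sum_(beta | (alpha, beta) != (ord_max, ord_max))
      (P a b alpha beta g + Q a b alpha beta g
       - lnorm1 (f a b alpha beta) *: Rm a b alpha beta)) v
    - int11_form r (\sum_(a < 2) \sum_(b < 2) \sum_alpha
      \sum_(beta | (alpha, beta) != (ord_max, ord_max))
      lnorm1 (f a b alpha beta) *: Sig a b alpha beta)
  <= \sum_(a < 2) \sum_(b < 2) \sum_alpha
      \sum_(beta | (alpha, beta) != (ord_max, ord_max))
      int11 (fun x => (f a b alpha beta).[x] * dern alpha (w a) x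
                      * dern beta (w b) x).
  rewrite qform_sum int11_form_sum // -sumrB; apply: ler_sum => a _.
  rewrite qform_sum int11_form_sum // -sumrB; apply: ler_sum => b _.
  rewrite qform_sum int11_form_sum // -sumrB; apply: ler_sum => alpha _.
  rewrite qform_sum int11_form_sum // -sumrB; apply: ler_sum => beta ne.
  exact: other.
apply: le_trans (lerD kk_part others).
move: QM_ge0 S_ge0; rewrite /QM /SigmaM -/f.
rewrite qformD qformB qform_congr 2!qformD qformZ (int11_formD cr (_ + _ + _)).
move: (int11 _) (int11_form r (\sum_a _)) (qform (\sum_a _) v) => ? ? ?.
move: (int11_form _ _) (qform _ (L *m v)) => ? ?.
clear; lra.
Qed.
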